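(* Let $q=p^n$ with $p$ a prime, $p\neq 3$, and let $L/\mathbb{F}_q(x)$ be a separable cubic extension with a generator $y$ satisfying $y^3-3y-a=0$, $a\in\mathbb{F}_q(x)$. Let $\alpha,\beta,\beta_1,\beta_2,\gamma,\omega,I$ and (depending on $p$) $\eta_2$, $\alpha_I$, $r$, $c$ be as defined in the context. Let $S,T,V\in\mathbb{F}_q[x]$ be such that $V\equiv T^2-3(\gamma\beta_1\beta_2)^2 \pmod I$, and such that $T$ satisfies the following congruences (such a $T$ exists by the Chinese remainder theorem): 1. if $p\neq 2$: $T\equiv -\dfrac{\alpha}{2\gamma^2\beta_2}\pmod{\eta_2^2}$ and $T\equiv 0\pmod{\beta_1^2}$; 2. if $p=2$: (a) if $L/\mathbb{F}_q(x)$ is Galois: $T\equiv 0\pmod{\beta_1}$ and $T\equiv \dfrac{r}{\gamma^2\beta_1^2\beta_2^2}\pmod{\alpha_I}$; (b) if $L/\mathbb{F}_q(x)$ is not Galois: $T\equiv 0\pmod{\beta_1}$ and $T\equiv\dfrac{\alpha c}{\gamma^2\beta_2}\pmod{\alpha_I}$. Then the set $$\mathfrak{B}=\left\{1,\ \omega+S,\ \frac{1}{I}\left(\omega^2+T\omega+V\right)\right\}$$ is an integral basis of $L/\mathbb{F}_q(x)$, i.e. an $\mathbb{F}_q[x]$-module basis of the integral closure $\mathcal{O}_{L,x}$ of $\mathbb{F}_q[x]$ in $L$.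
   Context: Notation. Finite places of $\mathbb{F}_q(x)$ are those corresponding to monic irreducible polynomials of $\mathbb{F}_q[x]$; $v_\mathfrak{p}$ denotes the normalized valuation at $\mathfrak{p}$. In congruences, division by a polynomial coprime to the modulus means multiplication by its inverse modulo that modulus. Write $a=\alpha/(\gamma^3\beta)$ with $\alpha,\beta,\gamma\in\mathbb{F}_q[x]$, $(\alpha,\beta\gamma)=1$, $\beta$ cube-free, and $\beta=\beta_1\beta_2^2$ with $\beta_1,\beta_2\in\mathbb{F}_q[x]$ square-free. Put $\omega=\gamma\beta_1\beta_2 y$; it is integral over $\mathbb{F}_q[x]$ with minimal polynomial $X^3-3\gamma^2\beta_1^2\beta_2^2X-\alpha\beta_1^2\beta_2$ over $\mathbb{F}_q(x)$. Case $p\neq 2$: write $4\gamma^6\beta^2-\alpha^2=\eta_1\eta_2^2$ with $\eta_1,\eta_2\in\mathbb{F}_q[x]$, $\eta_1$ square-free, and put $I=\beta_1\eta_2$. Case $p=2$: let $r$ be a root (in an algebraic closure of $\mathbb{F}_q(x)$) of the quadratic resolvent of the minimal polynomial of $\omega$, namely $$X^2+\alpha\beta_1^2\beta_2X+\beta_1^4\beta_2^2(\gamma^6\beta_1^2\beta_2^4+\alpha^2).$$ $L/\mathbb{F}_q(x)$ is Galois if and only if $r\in\mathbb{F}_q(x)$. By Artin–Schreier theory (Hasse's global standard form) there is a generator $z$ of $\mathbb{F}_q(x,r)/\mathbb{F}_q(x)$ with $z^2-z=b$, where $b=\frac{1}{a^2}+1+\eta^2-\eta$ for some $\eta\in\mathbb{F}_q(x)$,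 such that every finite place $\mathfrak{p}$ ramified in $\mathbb{F}_q(x,r)$ has $v_\mathfrak{p}(b)<0$ and $v_\mathfrak{p}(b)$ odd, and every place $\mathfrak{p}\mid(\alpha)$ unramified in $\mathbb{F}_q(x,r)$ has $v_\mathfrak{p}(b)\ge 0$. For $\mathfrak{p}\mid(\alpha)$ put $\ell_\mathfrak{p}=-v_\mathfrak{p}(b)$ if $\mathfrak{p}$ is ramified in $\mathbb{F}_q(x,r)$, and $\ell_\mathfrak{p}=-1$ if it is unramified. Write $\alpha=\prod_{i=1}^s\alpha_i^{v_{\mathfrak{p}_i}(\alpha)}$ (up to a nonzero constant) with $\alpha_i$ distinct irreducible polynomials corresponding to the finite places $\mathfrak{p}_i$. Put $I=\beta_1\alpha_I$, where $\alpha_I=\prod_{i=1}^s\alpha_i^{v_{\mathfrak{p}_i}(\alpha)-\frac12(\ell_{\mathfrak{p}_i}+1)}$ if $L/\mathbb{F}_q(x)$ is not Galois, and $\alpha_I=\alpha$ if $L/\mathbb{F}_q(x)$ is Galois. In the non-Galois case, $c\in\mathbb{F}_q(x)$ is any element (one exists by Hasse's standard form) such that $v_{\mathfrak{p}_i}\left(c^2+c+\frac{\gamma^6\beta_1^2\beta_2^4}{\alpha^2}+1\right)=-\ell_{\mathfrak{p}_i}$ for each $\mathfrak{p}_i\mid(\alpha)$ ramified in $\mathbb{F}_q(x,r)$, and $v_\mathfrak{p}\left(c^2+c+\frac{\gamma^6\beta_1^2\beta_2^4}{\alpha^2}+1\right)\ge 0$ for all other finite places $\mathfrak{p}$ of $\mathbb{F}_q(x)$.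 *)

(* Defs.v *)
From HB Require Import structures.
From mathcomp Require Import all_boot all_order all_algebra all_field.

Set Implicit Arguments.
Unset Strict Implicit.
Unset Printing Implicit Defensive.

Import Order.TTheory GRing.Theory Num.Theory.
Local Open Scope ring_scope.

Notation ratfun F := {fraction {poly F}}.
Notation "x %:F" := (FracField.tofrac x) : ring_scope.

(** * Polynomials *)

(* [k = 2]: square-free; [k = 3]: cube-free.  The zero polynomial has size 0,
   so the case [P = 0] excludes [f = 0]. *)
Definition power_free (F : fieldType) (k : nat) (f : {poly F}) : Prop :=
  forall P : {poly F}, size P != 1 -> ~~ (P ^+ k %| f).

Definition eqmodp (F : fieldType) (M f g : {poly F}) : bool := M %| f - g.

(* [T = k modulo M] for a rational function [k] whose denominator is invertible
   modulo [M]: [k = A / B] is read as [A * U], with [U] the inverse of [B]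
   modulo [M]. *)
Definition eqmodf (F : fieldType) (M T : {poly F}) (k : ratfun F) : Prop :=
  exists A B U : {poly F},
    [/\ B != 0, k = A%:F / B%:F, eqmodp M (B * U) 1 & eqmodp M T (A * U)].

(** * Finite places of F(x) and their valuations *)

Definition finite_place (F : fieldType) (P : {poly F}) : Prop :=
  P \is monic /\ irreducible_poly P.

Definition vpoly (F : fieldType) (P f : {poly F}) : nat :=
  \max_(k < size f | P ^+ k %| f) k.

(* Junk value at [0], where the valuation is [+oo]; the predicates below take
   care of that case. *)
Definition vfrac (F : fieldType) (P : {poly F}) (f : ratfun F) : int :=
  (vpoly P (\n_(repr f)))%:Z - (vpoly P (\d_(repr f)))%:Z.

Definition vfrac_eq (F : fieldType) (P : {poly F}) (f : ratfun F) (m : int) :=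
  f != 0 /\ vfrac P f = m.

Definition vfrac_ge0 (F : fieldType) (P : {poly F}) (f : ratfun F) : Prop :=
  f != 0 -> 0 <= vfrac P f.

(** * Ramification of a finite place in a finite extension of F(x) *)

(* Values of [w] at [0] and outside [M] are irrelevant. *)
Definition normalized_valuation (F : fieldType)
    (Omega : fieldExtType (ratfun F)) (M : {subfield Omega})
    (w : Omega -> int) : Prop :=
  [/\ {in M &, forall u v, u != 0 -> v != 0 -> w (u * v) = w u + w v},
      {in M &, forall u v, u != 0 -> v != 0 -> u + v != 0 ->
         Num.min (w u) (w v) <= w (u + v)}
    & exists u, [/\ u \in M, u != 0 & w u = 1]].

Definition lies_above (F : fieldType) (Omega : fieldExtType (ratfun F))
    (w : Omega -> int) (P : {poly F}) (e : nat) : Prop :=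
  forall f : ratfun F, f != 0 -> w f%:A = e%:Z * vfrac P f.

Definition ramified (F : fieldType) (Omega : fieldExtType (ratfun F))
    (M : {subfield Omega}) (P : {poly F}) : Prop :=
  exists (w : Omega -> int) (e : nat),
    [/\ normalized_valuation M w, lies_above w P e & (1 < e)%N].

(** * Integral closure of F[x] and integral bases *)

Definition polyin (F : fieldType) (Omega : fieldExtType (ratfun F))
  (f : {poly F}) : Omega := (f%:F)%:A.

Definition integral_closure (F : fieldType) (Omega : fieldExtType (ratfun F))
    (L : {subfield Omega}) (u : Omega) : Prop :=
  u \in L /\ integralOver (@polyin F Omega) u.

Definition integral_basis (F : fieldType) (Omega : fieldExtType (ratfun F))
    (L : {subfield Omega}) (n : nat) (B : n.-tuple Omega) : Prop :=
  (forall u : Omega, integral_closure L u <->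
     exists k : 'I_n -> {poly F}, u = \sum_i polyin Omega (k i) * tnth B i) /\
  (forall k : 'I_n -> {poly F},
     \sum_i polyin Omega (k i) * tnth B i = 0 -> forall i, k i = 0).

(** * The modulus I and the congruences on T *)

Definition odd_case (F : fieldType)
    (alpha beta beta1 beta2 gamma I T : {poly F}) : Prop :=
  exists eta1 eta2 : {poly F},
    [/\ 4%:R * gamma ^+ 6 * beta ^+ 2 - alpha ^+ 2 = eta1 * eta2 ^+ 2,
        power_free 2 eta1,
        I = beta1 * eta2,
        eqmodf (eta2 ^+ 2) T (- (alpha%:F / (2%:R * gamma ^+ 2 * beta2)%:F))
      & eqmodp (beta1 ^+ 2) T 0].

Definition resolvent_root (F : fieldType) (Omega : fieldExtType (ratfun F))
    (alpha beta1 beta2 gamma : {poly F}) (r : Omega) : Prop :=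
  r ^+ 2 + polyin Omega (alpha * beta1 ^+ 2 * beta2) * r
    + polyin Omega (beta1 ^+ 4 * beta2 ^+ 2
        * (gamma ^+ 6 * beta1 ^+ 2 * beta2 ^+ 4 + alpha ^+ 2)) = 0.

(* Characteristic 2; [Fr] is F(x, r). *)
Definition hasse_form (F : fieldType) (Omega : fieldExtType (ratfun F))
    (Fr : {subfield Omega}) (a : ratfun F) (alpha : {poly F})
    (b : ratfun F) : Prop :=
  [/\ exists2 z : Omega, <<1; z>>%VS = Fr & z ^+ 2 - z = b%:A,
      exists eta : ratfun F, b = 1 / a ^+ 2 + 1 + eta ^+ 2 - eta,
      forall P, finite_place P -> ramified Fr P ->
        [/\ b != 0, vfrac P b < 0 & ~~ (2 %| vfrac P b)%Z]
    & forall P, finite_place P -> P %| alpha -> ~ ramified Fr P ->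
        vfrac_ge0 P b].

Definition ell_spec (F : fieldType) (Omega : fieldExtType (ratfun F))
    (Fr : {subfield Omega}) (alpha : {poly F}) (b : ratfun F)
    (ell : {poly F} -> int) : Prop :=
  forall P, finite_place P -> P %| alpha ->
    (ramified Fr P -> ell P = - vfrac P b) /\ (~ ramified Fr P -> ell P = -1).

Definition factorization (F : fieldType) (alpha : {poly F})
    (s : seq {poly F}) : Prop :=
  [/\ uniq s,
      forall P, P \in s -> finite_place P /\ P %| alpha
    & exists2 k : F, k != 0 & alpha = k *: \prod_(P <- s) P ^+ vpoly P alpha].

(* The exponents are integers: [ell P] is odd, so the division by 2 is exact. *)
Definition alphaI_spec (F : fieldType) (alpha : {poly F}) (s : seq {poly F})
    (ell : {poly F} -> int) (alphaI : {poly F}) : Prop :=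
  alphaI%:F =
    \prod_(P <- s) P%:F ^ ((vpoly P alpha)%:Z - ((ell P + 1) %/ 2)%Z).

Definition c_spec (F : fieldType) (Omega : fieldExtType (ratfun F))
    (Fr : {subfield Omega}) (alpha beta1 beta2 gamma : {poly F})
    (ell : {poly F} -> int) (c : ratfun F) : Prop :=
  let d := c ^+ 2 + c
    + (gamma ^+ 6 * beta1 ^+ 2 * beta2 ^+ 4)%:F / (alpha ^+ 2)%:F + 1 in
  forall P, finite_place P ->
    (P %| alpha /\ ramified Fr P -> vfrac_eq P d (- ell P)) /\
    (~ (P %| alpha /\ ramified Fr P) -> vfrac_ge0 P d).

Definition even_galois_case (F : fieldType) (Omega : fieldExtType (ratfun F))
    (r : Omega) (alpha beta1 beta2 gamma I T : {poly F}) : Prop :=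
  exists2 r0 : ratfun F, r = r0%:A &
    [/\ I = beta1 * alpha,
        eqmodp beta1 T 0
      & eqmodf alpha T (r0 / (gamma ^+ 2 * beta1 ^+ 2 * beta2 ^+ 2)%:F)].

Definition even_nongalois_case (F : fieldType)
    (Omega : fieldExtType (ratfun F)) (r : Omega) (a : ratfun F)
    (alpha beta1 beta2 gamma I T : {poly F}) : Prop :=
  exists (b : ratfun F) (ell : {poly F} -> int) (s : seq {poly F})
      (alphaI : {poly F}) (c : ratfun F),
    [/\ hasse_form <<1; r>>%AS a alpha b,
        ell_spec <<1; r>>%AS alpha b ell,
        factorization alpha s,
        alphaI_spec alpha s ell alphaI
      & c_spec <<1; r>>%AS alpha beta1 beta2 gamma ell c] /\
    [/\ I = beta1 * alphaI,
        eqmodp beta1 T 0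
      & eqmodf alphaI T (alpha%:F * c / (gamma ^+ 2 * beta2)%:F)].

(* [Omega] is an arbitrary finite normal extension of F(x) containing [L] and a
   root [r] of the resolvent; it stands in for an algebraic closure. *)
Definition even_case (F : fieldType) (Omega : splittingFieldType (ratfun F))
    (L : {subfield Omega}) (a : ratfun F)
    (alpha beta1 beta2 gamma I T : {poly F}) : Prop :=
  exists2 r : Omega, resolvent_root alpha beta1 beta2 gamma r &
    (galois 1 L -> even_galois_case r alpha beta1 beta2 gamma I T) /\
    (~~ galois 1 L -> even_nongalois_case r a alpha beta1 beta2 gamma I T).

(* Main.v *)
(* With [m = gamma beta1 beta2], [M = m^2] and [H = alpha beta1^2 beta2] one has
   [omega^3 = 3 M omega + H].  A trace-zero element
   [z = x omega + y (omega^2 - 2 M)] satisfies [z^3 = 3 hess(x, y) z + jac(x, y)],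
   where [hess(x, y) = M x^2 + H x y + M^2 y^2] has discriminant [H^2 - 4 M^3]
   and [jac] is a binary cubic form; so if [z] is integral then [hess(x, y)] and
   [jac(x, y)] are polynomials.  As 3 is invertible, an integral element is the
   sum of a polynomial and a trace-zero integral element, and it suffices that,
   for each prime [P], [(b omega + c (omega^2 + T omega - 2 M) / I) / P] is
   integral only if [P] divides [b] and [c].  At primes dividing [beta1 beta2]
   (total tame ramification) this is read off [jac], at the others off [hess].

   For odd [p] the discriminant of [hess], divided by [I^2], is
   [- beta1^2 beta2^2 eta1], which is square-free away from [beta1 beta2].  In
   characteristic 2 it is the square of [beta1 beta2 alpha / alpha_I].  If [L] is
   not Galois and [P] divides [alpha / alpha_I], then
   [hess(alpha c / (gamma^2 beta2), 1) / alpha_I^2] has valuation exactly 1 at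
   [P], because Hasse's normal form has a pole of odd order there; hence
   maximality at [P].  The congruences on [T] express that [T] agrees with the
   distinguished argument of [hess] to the precision that makes [hess(T, 1)]
   divisible by [I^2]. *)
Require Import Defs.
From HB Require Import structures.
From mathcomp Require Import all_boot all_order all_algebra all_field.
From mathcomp Require Import generic_quotient ring.

Set Implicit Arguments.
Unset Strict Implicit.
Unset Printing Implicit Defensive.

Import Order.TTheory GRing.Theory Num.Theory.
Local Open Scope ring_scope.

(** * Valuations of polynomials and rational functions *)

Section Polynomials.

Variable F : fieldType.
Implicit Types P Q f g : {poly F}.

Lemma irredp_size_gt1 P : irreducible_poly P -> (1 < size P)%N.
Proof. by case. Qed.

Lemma irredp_coprime P f : irreducible_poly P -> ~~ (P %| f) -> coprimep P f.
Proof. by move=> irrP nPf; rewrite irreducible_poly_coprime. Qed.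

Lemma irredp_dvdM P f g :
  irreducible_poly P -> (P %| f * g) = (P %| f) || (P %| g).
Proof.
move=> irrP; apply/idP/orP => [|[]]; last 2 first.
- exact: dvdp_mulr.
- exact: dvdp_mull.
have [|nPf] := boolP (P %| f); first by left.
by rewrite Gauss_dvdpr ?irredp_coprime //; right.
Qed.

Lemma irredp_dvdX P f n :
  irreducible_poly P -> P %| f ^+ n -> P %| f.
Proof.
move=> irrP; elim: n => [|n IHn]; last first.
  by rewrite exprS irredp_dvdM // => /orP[].
by rewrite expr0 dvdp1 => /eqP sP; case: irrP; rewrite sP.
Qed.

Lemma irredp_not_dvd1 P f : irreducible_poly P -> size f = 1 -> ~~ (P %| f).
Proof.
move=> irrP sf; apply: contraTN (irredp_size_gt1 irrP) => /dvdp_leq.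
by rewrite -size_poly_eq0 sf -leqNgt => ->.
Qed.

Lemma irredp_size_neq1 P : irreducible_poly P -> size P != 1.
Proof. by case=> + _; rewrite neq_ltn orbC => ->. Qed.

Lemma irredp_coprime_dvd P f g :
  irreducible_poly P -> coprimep f g -> P %| f -> ~~ (P %| g).
Proof.
move=> irrP cop Pf; apply: contraTN cop => Pg.
apply/negP; rewrite coprimep_def => /eqP sg.
by have := irredp_not_dvd1 irrP sg; rewrite dvdp_gcd Pf Pg.
Qed.

(** Either some proper factor has smaller size, or the polynomial is itself irreducible. This
    alternative is not decided over an arbitrary field, hence [classically], which suffices for
    boolean goals. *)
Lemma classically_irredp_dvd f :
  (1 < size f)%N -> classically (exists2 P, irreducible_poly P & P %| f).
Proof.
move=> + b Hb; have [n] := ubnP (size f).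
elim: n f Hb => // n IHn f Hb sfn sf.
apply: (@classic_EM (exists q : {poly F},
  [/\ size q != 1, q %| f & ~~ (q %= f)])) => -[[q [sq qf nqf]]|nq].
- have f0 : f != 0 by rewrite -size_poly_gt0 ltnW.
  have q0 : q != 0 by apply: contraNneq f0 => q0; rewrite -dvd0p -q0.
  apply: (IHn q).
  + by case=> P irrP Pq; apply: Hb; exists P => //; apply: dvdp_trans qf.
  + apply: (@leq_trans (size f)) => //; rewrite ltn_neqAle dvdp_leq // andbT.
    by apply: contra nqf; rewrite -dvdp_size_eqp.
  + by move: sq q0; rewrite -size_poly_gt0; case: (size q) => [|[]].
- apply: Hb; exists f => //; split=> // q sq qf.
  by apply: contraT => nqf; case: nq; exists q.
Qed.

Lemma monic_associate P :
  irreducible_poly P -> exists2 Q, finite_place Q & P %= Q.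
Proof.
move=> irrP; have lc0 : (lead_coef P)^-1 != 0.
  by rewrite invr_eq0 lead_coef_eq0 irredp_neq0.
have PQ : P %= (lead_coef P)^-1 *: P by rewrite eqp_sym eqp_scale.
exists ((lead_coef P)^-1 *: P) => //; split.
  by rewrite monicE lead_coefZ mulVf // -invr_eq0.
split=> [|q sq]; first by rewrite size_scale //; case: irrP.
by rewrite -(eqp_dvdr _ PQ) -(eqp_rtrans PQ); case: irrP => _; apply.
Qed.

Lemma finite_place_dvd P Q :
  finite_place P -> finite_place Q -> P %| Q -> P = Q.
Proof.
move=> [mP irrP] [mQ [_ irrQ]] /irrQ PQ; apply/eqP; rewrite -eqp_monic //.
by apply: PQ; rewrite neq_ltn orbC; case: irrP => ->.
Qed.

Lemma expp_not_dvd P f n :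
  P ^+ n * f != 0 -> ~~ (P %| f) -> ~~ (P ^+ n.+1 %| P ^+ n * f).
Proof.
by rewrite mulf_eq0 negb_or => /andP[Pn0 _]; rewrite exprSr dvdp_mul2l.
Qed.

(** The bound [k < size f] in [vpoly] loses nothing: for nonconstant [P], [P ^+ n %| f] forces
    [n < size f]. *)
Lemma dvd_vpoly P f n : (1 < size P)%N -> f != 0 ->
  (P ^+ n %| f) = (n <= vpoly P f)%N.
Proof.
move=> sP f0; apply/idP/idP => [Pf|le_n].
  have ltn : (n < size f)%N.
    apply: leq_trans (dvdp_leq f0 Pf).
    rewrite -(prednK (n := size (P ^+ n))) ?size_poly_gt0 ?expf_neq0 //; last first.
      by rewrite -size_poly_gt0 ltnW.
    rewrite ltnS size_exp; case: (size P) sP => [|[|s]] //= _.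
    by rewrite leq_pmull.
  exact: (@leq_bigmax_cond _ (fun k : 'I_(size f) => P ^+ k %| f)
    (fun k => nat_of_ord k) (Ordinal ltn)).
apply: dvdp_trans (dvdp_exp2l P le_n) _; rewrite /vpoly.
have sf : (0 < size f)%N by rewrite size_poly_gt0.
have [|k Pk ->] := @eq_bigmax_cond _ (fun k : 'I_(size f) => P ^+ k %| f)
    (fun k => nat_of_ord k).
  by apply/card_gt0P; exists (Ordinal sf); rewrite unfold_in /= expr0 dvd1p.
exact: Pk.
Qed.

Lemma vpoly_decomp P f : (1 < size P)%N -> f != 0 ->
  exists2 g, f = P ^+ vpoly P f * g & ~~ (P %| g).
Proof.
move=> sP f0; have /dvdpP[g fE] : P ^+ vpoly P f %| f by rewrite dvd_vpoly.
exists g; first by rewrite mulrC.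
apply: contraT => /negPn Pg.
have : P ^+ (vpoly P f).+1 %| f by rewrite {2}fE exprS dvdp_mul.
by rewrite dvd_vpoly // ltnn.
Qed.

Lemma vpoly_unique P g n : irreducible_poly P -> ~~ (P %| g) ->
  vpoly P (P ^+ n * g) = n.
Proof.
move=> irrP nPg; have sP := irredp_size_gt1 irrP.
have f0 : P ^+ n * g != 0.
  rewrite mulf_neq0 ?expf_neq0 ?(irredp_neq0 irrP) //.
  by apply: contraNneq nPg => ->; rewrite dvdp0.
apply/eqP; rewrite eqn_leq -dvd_vpoly // dvdp_mulIl andbT leqNgt.
by rewrite -dvd_vpoly // expp_not_dvd.
Qed.

Lemma vpolyM P f g : irreducible_poly P -> f != 0 -> g != 0 ->
  vpoly P (f * g) = (vpoly P f + vpoly P g)%N.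
Proof.
move=> irrP f0 g0; have sP := irredp_size_gt1 irrP.
have [f1 {1}-> nf] := vpoly_decomp sP f0.
have [g1 {1}-> ng] := vpoly_decomp sP g0.
rewrite mulrACA -exprD vpoly_unique //.
by rewrite irredp_dvdM // negb_or nf.
Qed.

Lemma vpoly_eq0 P f : irreducible_poly P -> ~~ (P %| f) -> vpoly P f = 0%N.
Proof. by move=> irrP nPf; rewrite -(vpoly_unique 0 irrP nPf) mul1r. Qed.

Lemma vpolyX P f n : irreducible_poly P -> f != 0 ->
  vpoly P (f ^+ n) = (n * vpoly P f)%N.
Proof.
move=> irrP f0; elim: n => [|n IHn].
  by rewrite vpoly_eq0 // expr0 irredp_not_dvd1 ?size_poly1.
by rewrite exprS vpolyM ?expf_neq0 // IHn mulSn.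
Qed.

Lemma fracE (x : ratfun F) : x = (\n_(repr x))%:F / (\d_(repr x))%:F.
Proof.
have d0 : (\d_(repr x))%:F != 0 by rewrite tofrac_eq0 denom_ratioP.
apply: (canRL (mulfK d0)); rewrite -{1}[x]reprK.
rewrite !piE /FracField.mulf; apply/eqmodP; rewrite /= FracField.equivfE.
by rewrite !numden_Ratio ?mulr1 ?denom_ratioP ?oner_neq0 // mulrC.
Qed.

Lemma frac_coprime (x : ratfun F) :
  exists n d : {poly F}, [/\ d != 0, coprimep n d & x = n%:F / d%:F].
Proof.
set n := \n_(repr x); set d := \d_(repr x).
have d0 : d != 0 by exact: denom_ratioP.
have g0 : gcdp n d != 0 by rewrite gcdp_eq0 negb_and d0 orbT.
have nE : n = n %/ gcdp n d * gcdp n d by rewrite divpK ?dvdp_gcdl.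
have dE : d = d %/ gcdp n d * gcdp n d by rewrite divpK ?dvdp_gcdr.
exists (n %/ gcdp n d), (d %/ gcdp n d); split.
- by apply: contraNneq d0 => d'0; rewrite dE d'0 mul0r.
- by rewrite coprimep_div_gcd ?d0 ?orbT.
- rewrite [LHS]fracE -/n -/d.
  have -> : n%:F = (n %/ gcdp n d)%:F * (gcdp n d)%:F by rewrite -tofracM -nE.
  have -> : d%:F = (d %/ gcdp n d)%:F * (gcdp n d)%:F by rewrite -tofracM -dE.
  by rewrite -mulf_div divff ?mulr1 // tofrac_eq0.
Qed.

(** [vfrac] is computed on a chosen representative; cross-multiplication and the additivity of
    [vpoly] make the result independent of that choice. *)
Lemma vfrac_div P f g : irreducible_poly P -> f != 0 -> g != 0 ->
  vfrac P (f%:F / g%:F) = (vpoly P f)%:Z - (vpoly P g)%:Z.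
Proof.
move=> irrP f0 g0; rewrite /vfrac; set x := f%:F / g%:F.
have d0 : \d_(repr x) != 0 by exact: denom_ratioP.
have x0 : x != 0 by rewrite mulf_neq0 ?invr_eq0 ?tofrac_eq0.
have n0 : \n_(repr x) != 0.
  apply: contraNneq x0 => n0; rewrite [X in X == _]fracE n0 rmorph0 mul0r //.
have : (f * \d_(repr x))%:F = (\n_(repr x) * g)%:F.
  rewrite !rmorphM; apply/eqP; rewrite -eqr_div ?tofrac_eq0 //.
  by rewrite -fracE.
move/eqP; rewrite tofrac_eq => /eqP /(congr1 (vpoly P)).
rewrite !vpolyM // => e; apply/eqP; rewrite subr_eq addrAC eq_sym subr_eq.
by rewrite -!PoszD e.
Qed.

Lemma vfracM P (x y : ratfun F) : irreducible_poly P -> x != 0 -> y != 0 ->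
  vfrac P (x * y) = vfrac P x + vfrac P y.
Proof.
move=> irrP; have [n [d [d0 _ ->]]] := frac_coprime x.
have [n' [d' [d'0 _ ->]]] := frac_coprime y.
rewrite !mulf_eq0 !invr_eq0 !tofrac_eq0 !negb_or => /andP[n0 _] /andP[n'0 _].
rewrite mulf_div -!tofracM !vfrac_div ?mulf_neq0 // !vpolyM //.
by rewrite !PoszD opprD addrACA.
Qed.

Lemma vfrac_tofrac P f : irreducible_poly P -> f != 0 ->
  vfrac P f%:F = (vpoly P f)%:Z.
Proof.
move=> irrP f0; rewrite -[f%:F]mulr1 -[1]invr1 -[1]tofrac1 vfrac_div ?oner_neq0 //.
by rewrite [vpoly P 1]vpoly_eq0 ?subr0 // irredp_not_dvd1 ?size_poly1.
Qed.

(** In lowest terms, an irreducible factor of the denominator does not divide the numerator and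
    would be a pole, so the denominator is constant. *)
Lemma ratfun_poly (x : ratfun F) :
  (forall P, finite_place P -> vfrac_ge0 P x) -> exists f, x = f%:F.
Proof.
move=> xP; have [n [d [d0 cop xE]]] := frac_coprime x.
have [x0|x0] := eqVneq x 0; first by exists 0; rewrite tofrac0.
have n0 : n != 0 by apply: contraNneq x0 => n0; rewrite xE n0 tofrac0 mul0r.
suff /size_poly1P[c c0 dE] : size d == 1.
  exists (c^-1 *: n); rewrite xE dE -mul_polyC rmorphM mulrC; congr (_ * _).
  apply: (mulfI (x := c%:P%:F)); first by rewrite tofrac_eq0 polyC_eq0.
  rewrite mulfV ?tofrac_eq0 ?polyC_eq0 // -tofracM -polyCM mulfV //.
case: (ltngtP (size d) 1) => // sd.
  by move: sd d0; rewrite ltnS leqn0 size_poly_eq0 => ->.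
apply: (classically_irredp_dvd sd) => -[P irrP Pd].
have [Q fpQ PQ] := monic_associate irrP; have irrQ := fpQ.2.
have Qd : Q %| d by rewrite -(eqp_dvdl _ PQ).
have := xP Q fpQ x0; rewrite xE vfrac_div //.
have nQn : ~~ (Q %| n) by apply: irredp_coprime_dvd Qd; rewrite // coprimep_sym.
rewrite (vpoly_eq0 irrQ nQn).
rewrite sub0r oppr_ge0 lez_nat leqn0 => /eqP v0.
by have := dvd_vpoly 1 (irredp_size_gt1 irrQ) d0; rewrite v0 expr1 Qd.
Qed.

End Polynomials.

(** * Integral closedness of F[x] in F(x) *)

HB.instance Definition _ (F : fieldType) (Omega : fieldExtType (ratfun F)) :=
  GRing.RMorphism.copy (@polyin F Omega) (in_alg Omega \o @FracField.tofrac _).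

Section IntegrallyClosed.

Variables (F : fieldType) (Omega : splittingFieldType (ratfun F)).

Lemma polyin_eq0 (f : {poly F}) : (polyin Omega f == 0) = (f == 0).
Proof. by rewrite scaler_eq0 oner_eq0 orbF tofrac_eq0. Qed.

(** The rational root argument: clearing denominators in a monic equation of degree [k] gives
    [d %| n ^+ k], and [d], being coprime to [n], is constant. *)
Lemma integral_ratfun (x : ratfun F) :
  integralOver (@polyin F Omega) x%:A -> exists f, x = f%:F.
Proof.
case=> p mp rp; have [n [d [d0 cop xE]]] := frac_coprime x.
have dF0 : d%:F != 0 by rewrite tofrac_eq0.
have {rp} : (map_poly (@FracField.tofrac _) p).[x] = 0.
  apply: (fmorph_inj (in_alg Omega)); rewrite -horner_map rmorph0 /=.
  by rewrite -map_poly_comp; apply/eqP.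
have sp : (size p).-1.+1 = size p.
  by rewrite prednK // size_poly_gt0 monic_neq0.
rewrite horner_coef size_map_poly_id0; last first.
  by rewrite tofrac_eq0 lead_coef_eq0 monic_neq0.
rewrite -sp big_ord_recr /= coef_map /= -/(lead_coef p) (monicP mp).
rewrite tofrac1 mul1r; set k := (size p).-1 => px.
have dn : d %| n ^+ k.
  suff -> : n ^+ k = - (\sum_(i < k) p`_i * n ^+ i * d ^+ (k - i.+1)) * d.
    exact: dvdp_mull.
  apply/eqP; rewrite mulNr -addr_eq0 -tofrac_eq0 addrC; apply/eqP.
  transitivity (d%:F ^+ k * 0 : ratfun F); last by rewrite mulr0.
  rewrite -px mulrDr rmorphD rmorphXn rmorphM rmorph_sum /=; congr (_ + _).
    rewrite mulr_suml mulr_sumr; apply: eq_bigr => i _.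
    rewrite coef_map /= xE expr_div_n !rmorphM !rmorphXn /=.
    have -> : d%:F ^+ k = d%:F ^+ (k - i.+1) * d%:F * d%:F ^+ i :> ratfun F.
      by rewrite -exprSr -exprD -subSn // subSS subnK // ltnW.
    rewrite [RHS]mulrACA [X in _ = _ * X]mulrCA mulfV ?expf_neq0 // mulr1.
    by rewrite -[LHS]mulrA [LHS]mulrC !mulrA.
  rewrite xE expr_div_n mulrCA.
  by rewrite mulfV; [rewrite mulr1 | exact: expf_neq0].
suff : size d == 1.
  move=> /size_poly1P[c c0 dE]; exists (c^-1 *: n).
  apply: (mulIf dF0); rewrite xE divfK // -tofracM dE mulrC mul_polyC scalerA.
  by rewrite mulfV // scale1r.
have : coprimep d d.
  by apply: coprimep_dvdl dn _; rewrite coprimep_sym coprimep_expl.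
by rewrite coprimepp.
Qed.

End IntegrallyClosed.

(** * Integral elements of a cubic extension *)

Lemma eq_of_sub (V : zmodType) (a b c d : V) : a - b = c - d -> c = d -> a = b.
Proof. by move=> e cd; apply/eqP; rewrite -subr_eq0 e cd subrr. Qed.

(** * Binary forms attached to trace-zero elements *)

Section CubicForms.

Variable R : comNzRingType.

(** For the trace-zero element with coordinates [X] and [Y], the second symmetric function of the
    conjugates is -3 [hess] and the norm is [jac]. *)
Definition hess (M H X Y : R) : R := M * X ^+ 2 + H * X * Y + M ^+ 2 * Y ^+ 2.

Definition jac (M H X Y : R) : R :=
  H * X ^+ 3 + 6%:R * M ^+ 2 * X ^+ 2 * Y + 3%:R * M * H * X * Y ^+ 2
  + (H ^+ 2 - 2%:R * M ^+ 3) * Y ^+ 3.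

Lemma tracefree_expand (s x y w M : R) :
  s - 2%:R * y * M + x * w + y * w ^+ 2 = s + (x * w + y * (w ^+ 2 - 2%:R * M)).
Proof. by ring. Qed.

Lemma trace0_cubic (M H w X Y : R) : w ^+ 3 = 3%:R * M * w + H ->
  let z := X * w + Y * (w ^+ 2 - 2%:R * M) in
  z ^+ 3 - 3%:R * hess M H X Y * z - jac M H X Y = 0.
Proof. by move=> w3; rewrite /hess /jac /=; ring: w3. Qed.

Lemma shifted_cubic (s z a b : R) : z ^+ 3 - 3%:R * a * z - b = 0 ->
  (s + z) ^+ 3 - 3%:R * s * (s + z) ^+ 2 + 3%:R * (s ^+ 2 - a) * (s + z)
    + (3%:R * a * s - s ^+ 3 - b) = 0.
Proof. by move=> e; rewrite -[RHS]e; ring. Qed.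

(** Let f(X) = X^3 - 3 M X - H, a polynomial with root [w]. Then [I * r] is the divided difference
    of f at [w] and [T], formally -f(T) / (w - T), and reversing the Taylor expansion of f at [T]
    gives its cubic. The factor [I ^+ 3] stays because [R] is only a ring. *)
Lemma quotient_cubic (M H w T I A B r : R) : w ^+ 3 = 3%:R * M * w + H ->
  T ^+ 2 - M = I * A -> T ^+ 3 - 3%:R * M * T - H = I ^+ 2 * B ->
  I * r = w ^+ 2 + T * w + T ^+ 2 - 3%:R * M ->
  I ^+ 3 * (r ^+ 3 - 3%:R * A * r ^+ 2 + 3%:R * T * B * r - I * B ^+ 2) = 0.
Proof.
move=> w3 eA eB er.
transitivity ((I * r) ^+ 3 - 3%:R * (I * A) * (I * r) ^+ 2
  + 3%:R * T * (I ^+ 2 * B) * (I * r) - (I ^+ 2 * B) ^+ 2); first by ring.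
by rewrite er -eA -eB; ring: w3.
Qed.

End CubicForms.

Lemma hess_scale (K : fieldType) (M H X Y k : K) : k != 0 ->
  hess M H X Y = k ^+ 2 * hess M H (X / k) (Y / k).
Proof. by move=> k0; rewrite /hess; field. Qed.

Lemma jac_scale (K : fieldType) (M H X Y k : K) : k != 0 ->
  jac M H X Y = k ^+ 3 * jac M H (X / k) (Y / k).
Proof. by move=> k0; rewrite /jac; field. Qed.

Lemma rmorph_hess (R S : comNzRingType) (f : {rmorphism R -> S}) (M H X Y : R) :
  f (hess M H X Y) = hess (f M) (f H) (f X) (f Y).
Proof. by rewrite /hess !(rmorph_nat, rmorphM, rmorphXn, rmorphD, rmorphB). Qed.

Lemma rmorph_jac (R S : comNzRingType) (f : {rmorphism R -> S}) (M H X Y : R) :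
  f (jac M H X Y) = jac (f M) (f H) (f X) (f Y).
Proof.
rewrite /jac !rmorphD !rmorphM rmorphB !rmorphXn.
by rewrite !rmorphM !rmorph_nat.
Qed.

(* Conditions under which the order spanned by [1], [omega] and
   [(omega ^+ 2 + T * omega + V) / I], where
   [omega ^+ 3 = 3%:R * M * omega + H], is maximal at [P]: its discriminant is
   not divisible by [P ^+ 2]; the quadratic form of its trace-zero elements
   takes a value of valuation 1 at [(t1, t2)] (wild ramification at [P] in
   characteristic 2); [omega ^+ 2 / P], resp. [omega], is a uniformiser at a
   totally and tamely ramified [P]. *)
Inductive maximal_at (F : fieldType) (M H I T P : {poly F}) : Prop :=
| MaximalDisc of ~~ (P ^+ 2 * I ^+ 2 %| H ^+ 2 - 4%:R * M ^+ 3)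
| MaximalSimpleValue t1 t2 of
    ~~ (P %| M) & ~~ (P %| t2)
    & P * I %| 2%:R * M * (I * t1) + (2%:R * M * T + H) * t2
    & P * I ^+ 2 %| hess M H (I * t1 + T * t2) t2
    & ~~ (P ^+ 2 * I ^+ 2 %| hess M H (I * t1 + T * t2) t2)
| MaximalBeta1 I' T' H' M' of
    I = P * I' & ~~ (P %| I') & T = P * T' & H = P ^+ 2 * H' & ~~ (P %| H')
    & M = P ^+ 2 * M'
| MaximalBeta2 H' M' of
    ~~ (P %| I) & H = P * H' & ~~ (P %| H') & M = P ^+ 2 * M'.

(** * Cubic extensions of an abstract field [K] containing F[x] *)

Section CubicExtension.

Variables (F K : fieldType) (Omega : splittingFieldType K).
Variable iota : {rmorphism {poly F} -> K}.
Variable emb : {rmorphism {poly F} -> Omega}.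
Hypothesis embE : forall f, emb f = (iota f)%:A.
Hypothesis iota_inj : injective iota.
Hypothesis iota_closed :
  forall x : K, integralOver emb x%:A -> exists f, x = iota f.

Lemma algD (x y : K) : (x + y)%:A = x%:A + y%:A :> Omega.
Proof. exact: (rmorphD (in_alg Omega)). Qed.

Lemma algB (x y : K) : (x - y)%:A = x%:A - y%:A :> Omega.
Proof. exact: (rmorphB (in_alg Omega)). Qed.

Lemma algN (x : K) : (- x)%:A = - x%:A :> Omega.
Proof. exact: (rmorphN (in_alg Omega)). Qed.

Lemma algM (x y : K) : (x * y)%:A = x%:A * y%:A :> Omega.
Proof. exact: (rmorphM (in_alg Omega)). Qed.

Lemma algX (x : K) n : (x ^+ n)%:A = x%:A ^+ n :> Omega.
Proof. exact: (rmorphXn (in_alg Omega)). Qed.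

Lemma alg_nat n : (n%:R : K)%:A = n%:R :> Omega.
Proof. exact: (rmorph_nat (in_alg Omega)). Qed.

Lemma algV (x : K) : (x^-1)%:A = (x%:A)^-1 :> Omega.
Proof. exact: (fmorphV (in_alg Omega)). Qed.

Definition algE := (alg_nat, algM, algX, algD, algB, algN, algV).

Lemma integral_of_cubic (u : Omega) (f0 f1 f2 : {poly F}) :
  u ^+ 3 + emb f2 * u ^+ 2 + emb f1 * u + emb f0 = 0 -> integralOver emb u.
Proof.
move=> cu; pose q : {poly {poly F}} := Poly [:: f0; f1; f2; 1].
have qE : q = [:: f0; f1; f2; 1] :> seq _ by rewrite (PolyK (c := 0)) ?oner_neq0.
have sQ : (size (map_poly emb q) <= 4)%N by rewrite (leq_trans (size_poly _ _)) ?qE.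
exists q; first by rewrite monicE /lead_coef qE.
rewrite /root (horner_coef_wide _ sQ) !big_ord_recl big_ord0 !coef_map qE /=.
rewrite rmorph1 mul1r addr0; apply/eqP; rewrite -[RHS]cu.
by move: (emb f0) (emb f1) (emb f2) => *; ring.
Qed.

(** [Omega] is normal, so the minimal polynomial splits there, and all its roots are integral by the
    same monic equation. Its coefficients are then integral and lie in [K], hence are
    polynomials. *)
Lemma integral_minPoly (u : Omega) : integralOver emb u ->
  forall i, exists f, (minPoly 1 u)`_i = emb f.
Proof.
move=> intu i; have [p mp rp] := intu.
have [rs rsE] : exists rs, minPoly 1 u = \prod_(b <- rs) ('X - b%:P).
  have [rs _ ->] := elimT normalFieldP (normalFieldf 1%AS) u (memvf u).
  by exists rs.
have intc : integralOver emb (minPoly 1 u)`_i.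
  move: i; apply/integral_poly.
  have rsint b : b \in rs -> integralOver emb b.
    rewrite -root_prod_XsubC -rsE => mub; exists p => //.
    apply: root_dvdp mub; apply: minPoly_dvdp rp.
    apply/polyOver1P; exists (map_poly iota p).
    by rewrite -map_poly_comp; apply: eq_map_poly => f; rewrite embE.
  rewrite rsE; elim: rs {rsE} rsint => [|b rs IHrs] rsint.
    rewrite big_nil; apply/integral_poly => j; rewrite coef1.
    exact: integral_nat.
  rewrite big_cons; apply/integral_poly => j.
  have /integral_poly IH := IHrs (fun c crs => rsint c (@mem_behead _ (b :: rs) c crs)).
  rewrite mulrBl coefB coefXM coefCM; apply: integral_sub.
    by case: eqP => _; [apply: integral0 | apply: IH].
  by apply: integral_mul; [apply: rsint; rewrite mem_head | apply: IH].
have /polyOver1P[q qE] := minPolyOver 1 u.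
move: intc; rewrite qE coef_map => /iota_closed[f fE].
by exists f; rewrite embE -fE.
Qed.

(** The degree of [u] divides the prime 3 and is not 1, so the given cubic is the minimal polynomial
    of [u]. *)
Lemma integral_cubic (L : {subfield Omega}) (u : Omega) (c0 c1 c2 : K) :
  \dim L = 3%N -> u \in L -> u \notin 1%VS ->
  u ^+ 3 + c2%:A * u ^+ 2 + c1%:A * u + c0%:A = 0 ->
  integralOver emb u ->
  [/\ exists f, c0 = iota f, exists f, c1 = iota f & exists f, c2 = iota f].
Proof.
move=> dimL uL u1 cu /integral_minPoly intu.
have deg : adjoin_degree 1 u = 3%N.
  have := @field_dimS _ _ <<1; u>>%AS L; rewrite dim_Fadjoin dimv1 muln1 dimL.
  rewrite sub_adjoin1v uL => /(_ isT).
  case/primeP: (isT : prime 3) => _ /[apply] /orP[]/eqP // /eqP.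
  by rewrite adjoin_deg_eq1 (negPf u1).
pose q : {poly K} := Poly [:: c0; c1; c2; 1].
have qE : q = [:: c0; c1; c2; 1] :> seq _ by rewrite (PolyK (c := 0)) ?oner_neq0.
have mq : q \is monic by rewrite monicE /lead_coef qE.
pose Q := map_poly (in_alg Omega) q.
have mQ : Q \is monic by rewrite monic_map.
have sQ : size Q = 4%N by rewrite size_map_poly qE.
have rQ : root Q u.
  rewrite /root horner_coef sQ !big_ord_recl big_ord0 /= !coef_map /= qE /= /bump /=.
  rewrite scale1r addr0; apply/eqP; rewrite -[RHS]cu; ring.
have mE : minPoly 1 u = Q.
  apply/eqP; rewrite -eqp_monic ?monic_minPoly // -dvdp_size_eqp.
    by rewrite size_minPoly deg sQ.
  by apply: minPoly_dvdp => //; apply/polyOver1P; exists q.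
have H i : exists f, q`_i = iota f.
  have [f] := intu i; rewrite mE coef_map embE => /(fmorph_inj (in_alg Omega)) e.
  by exists f.
by split; [have := H 0%N | have := H 1%N | have := H 2%N]; rewrite qE.
Qed.

Variables (L : {subfield Omega}) (omega : Omega) (M H : {poly F}).
Hypothesis three_neq0 : 3%:R != 0 :> F.
Hypothesis dimL : \dim L = 3%N.
Hypothesis genL : <<1; omega>>%VS = L.
Hypothesis omega3 : omega ^+ 3 = 3%:R * emb M * omega + emb H.

(** The traces of [omega] and [omega ^+ 2] are 0 and 6 [M], whence the shift by 2 [M]. *)
Definition tracefree (x y : K) : Omega :=
  x%:A * omega + y%:A * (omega ^+ 2 - 2%:R * emb M).

Lemma tracefreeD x y x' y' :
  tracefree (x + x') (y + y') = tracefree x y + tracefree x' y'.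
Proof. by rewrite /tracefree !algD !mulrDl addrACA. Qed.

Lemma tracefreeM k x y : tracefree (k * x) (k * y) = k%:A * tracefree x y.
Proof. by rewrite /tracefree !algM -!mulrA -mulrDr. Qed.

Lemma alg_hess x y :
  (hess (iota M) (iota H) x y)%:A = hess (emb M) (emb H) x%:A y%:A.
Proof. by rewrite !embE; exact: (rmorph_hess (in_alg Omega)). Qed.

Lemma alg_jac x y :
  (jac (iota M) (iota H) x y)%:A = jac (emb M) (emb H) x%:A y%:A.
Proof. by rewrite !embE; exact: (rmorph_jac (in_alg Omega)). Qed.

Lemma omega_in_L : omega \in L.
Proof. by rewrite -genL memv_adjoin. Qed.

Lemma alg_in_L (x : K) : x%:A \in L.
Proof. exact: memvZ (mem1v L). Qed.

Lemma polyin_in_L f : emb f \in L.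
Proof. by rewrite embE alg_in_L. Qed.

Lemma degree_omega : adjoin_degree 1 omega = 3%N.
Proof. by have := dim_Fadjoin 1%AS omega; rewrite genL dimL dimv1 muln1. Qed.

Lemma omega_indep (s x y : K) :
  s%:A + x%:A * omega + y%:A * omega ^+ 2 = 0 -> [/\ s = 0, x = 0 & y = 0].
Proof.
move=> sxy; have [p pE] : exists p : {poly K}, forall i, p`_i = [:: s; x; y]`_i.
  by exists (Poly [:: s; x; y]) => i; rewrite coef_Poly.
pose q : {poly Omega} := map_poly (in_alg Omega) p.
have qover : q \is a polyOver 1%VS by apply/polyOver1P; eexists.
have sq : (size q <= 3)%N.
  apply/leq_sizeP => j; case: j => [|[|[|j]]] // _.
  by rewrite coef_map pE /= nth_nil scale0r.
have sq' : (size q <= adjoin_degree 1%AS omega)%N by rewrite degree_omega.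
have := @root_small_adjoin_poly _ _ 1%AS omega q qover sq'.
rewrite /root (horner_coef_wide _ sq) !big_ord_recl big_ord0 /= !coef_map /=.
rewrite !pE /= => e.
have {}e : q == 0 by rewrite -e expr0 mulr1 addr0 addrA; apply/eqP.
move: e; rewrite map_poly_eq0 => /eqP/polyP e.
by split; [have := e 0%N | have := e 1%N | have := e 2%N];
  rewrite coef0 pE.
Qed.

Lemma tracefree_indep (s x y : K) :
  s%:A + tracefree x y = 0 -> [/\ s = 0, x = 0 & y = 0].
Proof.
rewrite /tracefree => e.
have [|s0 -> y0] := @omega_indep (s - 2%:R * y * (iota M)) x y.
  by rewrite -e !algE -embE tracefree_expand.
by split=> //; move: s0; rewrite y0 mulr0 mul0r subr0.
Qed.

Lemma span_L u : u \in L ->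
  exists s x y : K, u = s%:A + tracefree x y.
Proof.
rewrite -genL => uL; have := Fadjoin_poly_eq uL.
set q := Fadjoin_poly _ _ _.
have /polyOver1P[p pE] : q \is a polyOver 1%VS := Fadjoin_polyOver _ _ _.
have sq : (size q <= 3)%N by rewrite -degree_omega size_Fadjoin_poly.
rewrite (horner_coef_wide _ sq) !big_ord_recl big_ord0 /= pE !coef_map /=.
rewrite /bump /= => <-; exists (p`_0 + 2%:R * p`_2 * (iota M)), p`_1, p`_2.
by rewrite /tracefree !algE -embE -tracefree_expand addrK expr0 mulr1 addr0 addrA.
Qed.

Lemma integral_omega : integralOver emb omega.
Proof.
apply: (@integral_of_cubic _ (- H) (- (3%:R * M)) 0).
by rewrite rmorph0 mul0r addr0 !rmorphN rmorphM rmorph_nat omega3; ring.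
Qed.

Lemma tracefree_notin1 x y : (x != 0) || (y != 0) -> tracefree x y \notin 1%VS.
Proof.
apply: contraTN => /vlineP[k e].
have [|_ -> ->] := @tracefree_indep (- k) x y; last by rewrite eqxx.
by rewrite e algN addNr.
Qed.

Lemma tracefree_in_L x y : tracefree x y \in L.
Proof.
have wL := omega_in_L; rewrite /tracefree rpredD ?rpredM ?alg_in_L ?rpredB //.
  by rewrite rpredX.
by rewrite rpredM ?rpredMn ?mem1v ?polyin_in_L.
Qed.

Lemma third_of_poly (x : K) f : 3%:R * x = iota f ->
  x = iota (3%:R^-1 *: f).
Proof.
have t0 : 3%:R != 0 :> K.
  by rewrite -(rmorph_nat iota) -(rmorph0 iota) (inj_eq iota_inj) -polyC_natr polyC_eq0.
move=> fE; apply: (mulfI t0); rewrite fE -(rmorph_nat iota).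
by rewrite -rmorphM -polyC_natr mul_polyC scalerA divff // scale1r.
Qed.

(** Outside [K], the element has a minimal polynomial with quadratic coefficient -3 [s], and 3 is
    invertible; otherwise [s] itself is integral over F[x]. *)
Lemma integral_trace (s x y : K) :
  integralOver emb (s%:A + tracefree x y) -> exists f, s = iota f.
Proof.
have [xy|/norP[/negPn/eqP-> /negPn/eqP->]] := boolP ((x != 0) || (y != 0)); last first.
  by rewrite /tracefree !scale0r !mul0r !addr0; apply: iota_closed.
move=> intu; have [] := @integral_cubic L _
   (3%:R * hess (iota M) (iota H) x y * s - s ^+ 3 - jac (iota M) (iota H) x y)
   (3%:R * (s ^+ 2 - hess (iota M) (iota H) x y)) (- (3%:R * s)) dimL _ _ _ intu.
- by rewrite rpredD ?alg_in_L ?tracefree_in_L.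
- by rewrite rpredDl ?tracefree_notin1 // rpredZ // mem1v.
- move: (alg_hess x y) (alg_jac x y).
  move: (hess (iota M) _ _ _) (jac (iota M) _ _ _) => h j hE jE.
  rewrite !algE mulNr; apply: shifted_cubic; rewrite hE jE.
  exact: trace0_cubic.
- move=> _ _ [f fE]; exists (3%:R^-1 *: - f); apply: third_of_poly.
  by rewrite rmorphN -fE opprK.
Qed.

Lemma integral_forms (x y : K) :
  integralOver emb (tracefree x y) ->
  (exists f, hess (iota M) (iota H) x y = iota f) /\
  (exists f, jac (iota M) (iota H) x y = iota f).
Proof.
have [xy|/norP[/negPn/eqP-> /negPn/eqP->] _] := boolP ((x != 0) || (y != 0)); last first.
  by split; exists 0; rewrite /hess /jac rmorph0; ring.
move=> intu; have [] := @integral_cubic L _ (- jac (iota M) (iota H) x y)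
   (- (3%:R * hess (iota M) (iota H) x y)) 0 dimL _ _ _ intu.
- exact: tracefree_in_L.
- exact: tracefree_notin1.
- move: (alg_hess x y) (alg_jac x y).
  move: (hess (iota M) _ _ _) (jac (iota M) _ _ _) => h j hE jE.
  rewrite scale0r mul0r addr0 !algE mulNr hE jE.
  exact: trace0_cubic.
- move=> [f fE] [g gE] _; split; last first.
    by exists (- f); rewrite rmorphN -fE opprK.
  exists (3%:R^-1 *: - g); apply: third_of_poly.
  by rewrite rmorphN -gE opprK.
Qed.

Hypothesis iota_frac : forall x : K, exists n d, d != 0 /\ x = iota n / iota d.

Variables (I T W A1 B1 : {poly F}).
Hypothesis I_neq0 : I != 0.
Hypothesis A1E : T ^+ 2 - M = I * A1.
Hypothesis B1E : T ^+ 3 - 3%:R * M * T - H = I ^+ 2 * B1.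

(** [M], [B], [C] are the coefficients of [hess] after the substitution (b I + c T, c) and division
    by [I ^+ 2]; see [hessE]. *)
Let B := T * A1 - I * B1.
Let C := A1 ^+ 2 - T * B1.

Lemma mixed_coefE : 2%:R * M * T + H = I * B.
Proof.
have -> : I * B = T * (I * A1) - I ^+ 2 * B1 by rewrite /B; ring.
by rewrite -A1E -B1E; ring.
Qed.

Lemma last_coefE : M * T ^+ 2 + H * T + M ^+ 2 = I ^+ 2 * C.
Proof.
have -> : I ^+ 2 * C = (I * A1) ^+ 2 - T * (I ^+ 2 * B1) by rewrite /C; ring.
by rewrite -A1E -B1E; ring.
Qed.

Definition qform (b c : {poly F}) := M * b ^+ 2 + B * b * c + C * c ^+ 2.

Lemma hessE b c : hess M H (b * I + c * T) c = I ^+ 2 * qform b c.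
Proof.
transitivity (M * I ^+ 2 * b ^+ 2 + (2%:R * M * T + H) * I * b * c
  + (M * T ^+ 2 + H * T + M ^+ 2) * c ^+ 2); first by rewrite /hess; ring.
by rewrite mixed_coefE last_coefE /qform; move: B C => *; ring.
Qed.

Lemma qform_shiftl b c P :
  qform (b + P) c = qform b c + P * (2%:R * M * b + B * c) + P ^+ 2 * M.
Proof. by rewrite /qform; move: B C => *; ring. Qed.

Lemma qform_shiftr b c P :
  qform b (c + P) = qform b c + P * (B * b + 2%:R * C * c) + P ^+ 2 * C.
Proof. by rewrite /qform; move: B C => *; ring. Qed.

(** The trace-zero part of b omega + c (omega^2 + T omega + V) / I. *)
Definition combination (b c : {poly F}) :=
  tracefree (iota (b * I + c * T) / iota I) (iota c / iota I).

Lemma combinationD b c b' c' :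
  combination (b + b') (c + c') = combination b c + combination b' c'.
Proof.
rewrite -tracefreeD -!mulrDl -!rmorphD addrACA -!mulrDl //.
Qed.

Lemma combinationM k b c :
  combination (k * b) (k * c) = emb k * combination b c.
Proof.
by rewrite embE -tracefreeM /combination -!mulrA -mulrDr !rmorphM !mulrA.
Qed.

Lemma iota_eq0 f : (iota f == 0) = (f == 0).
Proof. by rewrite -(inj_eq iota_inj) rmorph0. Qed.

Lemma emb_eq0 f : (emb f == 0) = (f == 0).
Proof. by rewrite embE scaler_eq0 oner_eq0 orbF iota_eq0. Qed.

Definition scaled_combination (D b c : {poly F}) := (emb D)^-1 * combination b c.

Lemma scaled_combinationE D b c : D != 0 -> scaled_combination D b c =
  tracefree (iota (b * I + c * T) / iota (D * I)) (iota c / iota (D * I)).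
Proof.
move=> D0; rewrite /scaled_combination embE -algV -tracefreeM rmorphM invfM.
by congr tracefree; rewrite mulrCA.
Qed.

(** [hess] and [jac] are homogeneous of degrees 2 and 3, so the common denominator [D * I] of the
    coordinates comes out as its square and its cube. *)
Lemma scaled_combination_forms D b c :
  D != 0 -> integralOver emb (scaled_combination D b c) ->
  D ^+ 2 %| qform b c /\ (D * I) ^+ 3 %| jac M H (b * I + c * T) c.
Proof.
move=> D0; have DI0 : iota (D * I) != 0 by rewrite iota_eq0 mulf_neq0.
rewrite scaled_combinationE // => /integral_forms[[f fE] [g gE]].
have fE' : I ^+ 2 * qform b c = (D * I) ^+ 2 * f.
  apply: iota_inj; rewrite -hessE rmorph_hess (hess_scale _ _ _ _ DI0) fE.
  by rewrite -rmorphXn -rmorphM.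
have gE' : jac M H (b * I + c * T) c = (D * I) ^+ 3 * g.
  apply: iota_inj; rewrite rmorph_jac (jac_scale _ _ _ _ DI0) gE.
  by rewrite -rmorphXn -rmorphM.
split; last by rewrite gE' dvdp_mulIl.
apply/dvdpP; exists f; apply: (mulfI (expf_neq0 2 I_neq0)).
by rewrite fE' exprMn mulrC mulrA mulrC.
Qed.

Lemma scaled_combination_qform D b c :
  D != 0 -> integralOver emb (scaled_combination D b c) -> D ^+ 2 %| qform b c.
Proof. by move=> D0 /(scaled_combination_forms D0)[]. Qed.

(** [W] is the quotient in the congruence on [V]; it merely translates the generator by a
    polynomial. *)
Definition quadratic_generator :=
  (emb I)^-1 * (omega ^+ 2 + emb T * omega + emb (T ^+ 2 - 3%:R * M + I * W)).

Lemma quadratic_generatorI : emb I * quadratic_generator =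
  omega ^+ 2 + emb T * omega + (emb T ^+ 2 - 3%:R * emb M) + emb I * emb W.
Proof.
rewrite mulVKf ?emb_eq0 // rmorphD rmorphB rmorphXn.
by rewrite [emb (3%:R * _)]rmorphM [emb (I * W)]rmorphM rmorph_nat addrA.
Qed.

Lemma embA1E : emb T ^+ 2 - emb M = emb I * emb A1.
Proof. by rewrite -rmorphM -A1E rmorphB rmorphXn. Qed.

Lemma quadratic_generatorE :
  quadratic_generator = combination 0 1 + emb (A1 + W).
Proof.
have I0 : emb I != 0 by rewrite emb_eq0.
apply: (mulfI I0); rewrite quadratic_generatorI [emb (A1 + W)]rmorphD.
rewrite [RHS]mulrDr [X in _ = _ + X]mulrDr -embA1E.
have -> : emb I * combination 0 1 = tracefree (iota T) 1.
  rewrite embE -tracefreeM /combination mul0r add0r mul1r rmorph1 mul1r.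
  by rewrite mulrC divfK ?divff ?iota_eq0.
rewrite /tracefree scale1r mul1r -embE.
by move: (emb T) (emb M) (emb I) (emb W) => *; ring.
Qed.

(** After subtraction of [W] this is the [r] of [quotient_cubic]; in a field [I ^+ 3] cancels, which
    leaves a monic cubic with polynomial coefficients. *)
Lemma integral_quadratic_generator : integralOver emb quadratic_generator.
Proof.
have I0 : emb I != 0 by rewrite emb_eq0.
pose r := quadratic_generator - emb W.
suff intr : integralOver emb r.
  rewrite -(subrK (emb W) quadratic_generator).
  exact: integral_add intr (integral_id _ _).
have rE : emb I * r = omega ^+ 2 + emb T * omega + emb T ^+ 2 - 3%:R * emb M.
  by rewrite mulrBr quadratic_generatorI addrK addrA.
have B1E' : emb T ^+ 3 - 3%:R * emb M * emb T - emb H = emb I ^+ 2 * emb B1.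
  have -> : emb I ^+ 2 * emb B1 = emb (I ^+ 2 * B1) by rewrite rmorphM rmorphXn.
  by rewrite -B1E rmorphB rmorphB rmorphXn rmorphM [emb (3%:R * _)]rmorphM rmorph_nat.
have /eqP := quotient_cubic omega3 embA1E B1E' rE.
rewrite mulf_eq0 expf_eq0 (negPf I0) andbF orFb => /eqP rcub.
apply: (@integral_of_cubic r (- (I * B1 ^+ 2)) (3%:R * T * B1) (- (3%:R * A1))).
rewrite -[RHS]rcub !rmorphN !rmorphM rmorph_nat.
by move: (emb T) (emb I) (emb B1) (emb A1) r {rE rcub} => *; ring.
Qed.

Lemma combinationE b c :
  combination b c = emb b * omega + emb c * combination 0 1.
Proof.
rewrite -combinationM mulr0 mulr1.
have -> : emb b * omega = combination b 0.
  rewrite /combination mul0r addr0 rmorphM mulfK ?iota_eq0 // rmorph0 mul0r.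
  by rewrite /tracefree scale0r mul0r addr0 embE.
by rewrite -combinationD addr0 add0r.
Qed.

Lemma integral_combination b c : integralOver emb (combination b c).
Proof.
rewrite combinationE; apply: integral_add; apply: integral_mul; try exact: integral_id.
  exact: integral_omega.
rewrite -(addrK (emb (A1 + W)) (combination 0 1)) -quadratic_generatorE.
exact: integral_sub integral_quadratic_generator (integral_id _ _).
Qed.

(** * Local maximality at one prime *)

Lemma integral_scaled_shift D b c b' c' :
  D != 0 -> integralOver emb (scaled_combination D b c) ->
  integralOver emb (scaled_combination D (b + D * b') (c + D * c')).
Proof.
move=> D0 intu; rewrite /scaled_combination combinationD combinationM.
rewrite mulrDr mulKf ?emb_eq0 //.
by apply: integral_add intu _; apply: integral_combination.
Qed.

(** Integrality survives the shifts of [b] or [c] by [P], so [P ^+ 2] divides three values of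
    [qform]; modulo [P ^+ 2] their differences are [P] times the partial derivatives. *)
Lemma scaled_combination_polar P b c :
  P != 0 -> integralOver emb (scaled_combination P b c) ->
  [/\ P ^+ 2 %| qform b c, P %| 2%:R * M * b + B * c
    & P %| B * b + 2%:R * C * c].
Proof.
move=> P0 intu; have qP := scaled_combination_qform P0 intu; split=> //.
- have := scaled_combination_qform P0 (integral_scaled_shift 1 0 P0 intu).
  rewrite mulr1 mulr0 addr0 qform_shiftl -addrA dvdp_addr //.
  by rewrite dvdp_addl ?dvdp_mulIl // expr2 dvdp_mul2l.
- have := scaled_combination_qform P0 (integral_scaled_shift 0 1 P0 intu).
  rewrite mulr1 mulr0 addr0 qform_shiftr -addrA dvdp_addr //.
  by rewrite dvdp_addl ?dvdp_mulIl // expr2 dvdp_mul2l.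
Qed.

(* [4 M qform b c = (2 M b + B c)^2 - (B^2 - 4 M C) c^2], and [P] divides both
   partial derivatives of [qform] at [(b, c)]. *)
Lemma maximal_of_disc P b c :
  irreducible_poly P -> ~~ (P ^+ 2 %| B ^+ 2 - 4%:R * M * C) ->
  integralOver emb (scaled_combination P b c) -> P %| b /\ P %| c.
Proof.
move=> irrP nPD /(scaled_combination_polar (irredp_neq0 irrP))[qP lP rP].
have main (x u v : {poly F}) : P %| u -> P ^+ 2 %| v ->
    (B ^+ 2 - 4%:R * M * C) * x ^+ 2 = u ^+ 2 - v -> P %| x.
  move=> Pu Pv e; apply: contraNT nPD => nPx.
  have cop : coprimep (P ^+ 2) (x ^+ 2).
    by rewrite coprimep_expl // coprimep_expr // irredp_coprime.
  by rewrite -(Gauss_dvdpl _ cop) e dvdp_sub // dvdp_exp2r.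
split.
- apply: (main _ _ (4%:R * C * qform b c) rP); first exact: dvdp_mull.
  by rewrite /qform; move: B C => *; ring.
- apply: (main _ _ (4%:R * M * qform b c) lP); first exact: dvdp_mull.
  by rewrite /qform; move: B C => *; ring.
Qed.

(** In terms of [u = t2 * b - t1 * c] one has t2^2 qform(b, c) = M u^2 + l u c + w c^2. As [P]
    divides [l] and [w], it divides [u]; then [P ^+ 2] divides w c^2, and since [w] has valuation 1,
    [P] divides [c]. *)
Lemma maximal_of_simple_value P t1 t2 b c : irreducible_poly P ->
  ~~ (P %| M) -> ~~ (P %| t2) -> P %| 2%:R * M * t1 + B * t2 ->
  P %| M * t1 ^+ 2 + B * t1 * t2 + C * t2 ^+ 2 ->
  ~~ (P ^+ 2 %| M * t1 ^+ 2 + B * t1 * t2 + C * t2 ^+ 2) ->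
  integralOver emb (scaled_combination P b c) -> P %| b /\ P %| c.
Proof.
set l := 2%:R * M * t1 + B * t2; set w := _ + C * t2 ^+ 2.
move=> irrP nPM nPt Pl Pw nPw; have P0 := irredp_neq0 irrP.
move=> /(scaled_combination_qform P0) qP; pose u := t2 * b - t1 * c.
have qE : t2 ^+ 2 * qform b c = M * u ^+ 2 + l * u * c + w * c ^+ 2.
  by rewrite /qform /l /w /u; move: B C => *; ring.
have Pu : P %| u.
  have : P %| M * u ^+ 2.
    rewrite -(@dvdp_addl _ (l * u * c + w * c ^+ 2) _ (M * u ^+ 2)); last first.
      by rewrite dvdp_add // -?mulrA dvdp_mulr.
    rewrite addrA -qE dvdp_mull //; apply: dvdp_trans qP.
    by rewrite expr2 dvdp_mulIl.
  by rewrite irredp_dvdM // (negPf nPM) => /(irredp_dvdX irrP).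
have Pc : P %| c.
  have {}qP : P ^+ 2 %| w * c ^+ 2.
    rewrite -(@dvdp_addr _ (M * u ^+ 2 + l * u * c) _ (w * c ^+ 2)).
      by rewrite -qE dvdp_mull.
    rewrite dvdp_add //; first by rewrite dvdp_mull // dvdp_exp2r.
    by rewrite dvdp_mulr // expr2 dvdp_mul.
  apply: contraNT nPw => nPc; move: qP; rewrite Gauss_dvdpl //.
  by rewrite coprimep_expl // coprimep_expr // irredp_coprime.
split=> //; have : P %| t2 * b.
  by rewrite -(subrK (t1 * c) (t2 * b)) -/u dvdp_add // dvdp_mull.
by rewrite irredp_dvdM // (negPf nPt).
Qed.

(** [P ^+ 3] divides jac(X, c). Modulo [P ^+ 2] only the term in X^3 survives, so [P] divides [X];
    then modulo [P ^+ 3] only H^2 c^3 survives, so [P] divides [c]. *)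
Lemma maximal_at_beta2 P H' M' b c : irreducible_poly P ->
  ~~ (P %| I) -> H = P * H' -> ~~ (P %| H') -> M = P ^+ 2 * M' ->
  integralOver emb (scaled_combination P b c) -> P %| b /\ P %| c.
Proof.
move=> irrP nPI HE nPH ME; have P0 := irredp_neq0 irrP.
case/(scaled_combination_forms P0) => _; rewrite exprMn => PJ.
have {PJ} [Q] : exists Q, jac M H (b * I + c * T) c = Q * P ^+ 3.
  by apply/dvdpP; apply: dvdp_trans PJ; exact: dvdp_mulIl.
rewrite HE ME /jac; set X := b * I + c * T => JE.
have /dvdpP[X' XE] : P %| X.
  have : P %| H' * X ^+ 3.
    rewrite -(dvdp_mul2l _ _ P0); apply/dvdpP.
    exists (Q * P - (6%:R * M' ^+ 2 * P ^+ 2 * X ^+ 2 * c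
      + 3%:R * P * M' * H' * X * c ^+ 2
      + (H' ^+ 2 - 2%:R * P ^+ 4 * M' ^+ 3) * c ^+ 3)).
    by apply: (eq_of_sub _ JE); ring.
  by rewrite irredp_dvdM // (negPf nPH) => /(irredp_dvdX irrP).
have Pc : P %| c.
  have : P %| H' ^+ 2 * c ^+ 3.
    rewrite -(dvdp_mul2l _ _ (expf_neq0 2 P0)); apply/dvdpP.
    exists (Q - (P * H' * X' ^+ 3 + 6%:R * P ^+ 3 * M' ^+ 2 * X' ^+ 2 * c
      + 3%:R * P * M' * H' * X' * c ^+ 2 - 2%:R * P ^+ 3 * M' ^+ 3 * c ^+ 3)).
    by apply: (eq_of_sub _ JE); rewrite XE; ring.
  rewrite irredp_dvdM // => /orP[/(irredp_dvdX irrP)|/(irredp_dvdX irrP) //].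
  by rewrite (negPf nPH).
split=> //; have : P %| b * I.
  by rewrite -(addrK (c * T) (b * I)) -/X dvdp_sub ?XE ?dvdp_mulIr // dvdp_mulr.
by rewrite irredp_dvdM // (negPf nPI) orbF.
Qed.

(** Here [P ^+ 6] divides jac(P X, c), and the roles are exchanged: modulo [P ^+ 5] only H^2 c^3
    survives and gives [P %| c], then modulo [P ^+ 6] only the term in X^3 survives. *)
Lemma maximal_at_beta1 P I' T' H' M' b c : irreducible_poly P ->
  I = P * I' -> ~~ (P %| I') -> T = P * T' ->
  H = P ^+ 2 * H' -> ~~ (P %| H') -> M = P ^+ 2 * M' ->
  integralOver emb (scaled_combination P b c) -> P %| b /\ P %| c.
Proof.
move=> irrP IE nPI TE HE nPH ME; have P0 := irredp_neq0 irrP.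
case/(scaled_combination_forms P0) => _ /dvdpP[Q]; pose X := b * I' + c * T'.
have -> : b * I + c * T = P * X by rewrite IE TE /X; ring.
rewrite HE ME IE /jac => JE.
have /dvdpP[c' cE] : P %| c.
  have : P %| H' ^+ 2 * c ^+ 3.
    rewrite -(dvdp_mul2l _ _ (expf_neq0 4 P0)); apply/dvdpP.
    exists (Q * I' ^+ 3 * P - (H' * X ^+ 3 + 6%:R * P * M' ^+ 2 * X ^+ 2 * c
      + 3%:R * M' * H' * X * c ^+ 2 - 2%:R * P * M' ^+ 3 * c ^+ 3)).
    by apply: (eq_of_sub _ JE); ring.
  rewrite irredp_dvdM // => /orP[/(irredp_dvdX irrP)|/(irredp_dvdX irrP) //].
  by rewrite (negPf nPH).
have PX : P %| X.
  have : P %| H' * X ^+ 3.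
    rewrite -(dvdp_mul2l _ _ (expf_neq0 5 P0)); apply/dvdpP.
    exists (Q * I' ^+ 3 - (6%:R * P * M' ^+ 2 * X ^+ 2 * c'
      + 3%:R * P * M' * H' * X * c' ^+ 2
      + (H' ^+ 2 * P - 2%:R * P ^+ 3 * M' ^+ 3) * c' ^+ 3)).
    by apply: (eq_of_sub _ JE); rewrite cE; ring.
  by rewrite irredp_dvdM // (negPf nPH) => /(irredp_dvdX irrP).
have Pc : P %| c by rewrite cE dvdp_mulIr.
split=> //; have : P %| b * I'.
  by rewrite -(addrK (c * T') (b * I')) -/X dvdp_sub // dvdp_mulr.
by rewrite irredp_dvdM // (negPf nPI) orbF.
Qed.

(** * From local maximality to an integral basis *)

Lemma denominator_dvd :
  (forall P b c, irreducible_poly P ->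
     integralOver emb (scaled_combination P b c) -> P %| b /\ P %| c) ->
  forall D b c, D != 0 -> integralOver emb (scaled_combination D b c) ->
    D %| b /\ D %| c.
Proof.
move=> locP D; have [n] := ubnP (size D); elim: n D => // n IHn D sD b c D0 intu.
have [sD1|sD1] := leqP (size D) 1.
  have D1 : size D == 1 by rewrite eqn_leq sD1 size_poly_gt0.
  by split; rewrite (eqp_dvdl _ (_ : D %= 1)) ?dvd1p // -size_poly_eq1.
(* One irreducible factor [P] of [D] is cancelled at a time: multiplication by the cofactor [D']
   leaves an integral element of denominator [P], to which the local hypothesis applies. *)
apply/andP; apply: (classically_irredp_dvd sD1) => -[P irrP /dvdpP[D' DE]].
have P0 := irredp_neq0 irrP.
have D'0 : D' != 0 by apply: contraNneq D0 => D'0; rewrite DE D'0 mul0r.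
have e1 : scaled_combination P b c = emb D' * scaled_combination D b c.
  by rewrite /scaled_combination DE rmorphM invfM -mulrA mulVKf ?emb_eq0.
have [|/dvdpP[b' bE] /dvdpP[c' cE]] := locP P b c irrP.
  by rewrite e1; apply: integral_mul intu; apply: integral_id.
have e2 : scaled_combination D b c = scaled_combination D' b' c'.
  rewrite /scaled_combination bE cE ![_ * P]mulrC combinationM DE rmorphM.
  by rewrite invfM -mulrA mulKf ?emb_eq0.
have [||] := IHn D' _ b' c' D'0.
- have sDE : size D = (size D' + size P).-1 by rewrite DE size_mul.
  move: sD (irredp_size_gt1 irrP); rewrite sDE.
  case: (size P) => [|[|k]] //; rewrite !addnS /= ltnS => le_n _.
  exact: leq_ltn_trans (leq_addr _ _) le_n.
- by rewrite -e2.
- by move=> Db Dc; rewrite DE bE cE !dvdp_mul2r // Db Dc.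
Qed.

Variable S : {poly F}.

(** [S] and [A1 + W] only affect the polynomial part, so the change to the trace-zero coordinates is
    unitriangular over F[x]. *)
Lemma sum_basisE (k : 'I_3 -> {poly F}) :
  \sum_i emb (k i) * tnth [tuple 1; omega + emb S; quadratic_generator] i =
  emb (k 0 + k 1 * S + k (inord 2) * (A1 + W)) + combination (k 1) (k (inord 2)).
Proof.
rewrite !big_ord_recl big_ord0 addr0 !(tnth_nth 0) /=.
have -> : lift ord0 ord0 = 1 :> 'I_3 by apply/val_inj.
have -> : lift ord0 (lift ord0 ord0) = inord 2 :> 'I_3.
  by apply/val_inj; rewrite /= inordK.
rewrite mulr1 quadratic_generatorE [combination (k 1) _]combinationE.
move: (k 0) (k 1) (k _) (combination 0 1) => k0 k1 k2 z.
rewrite !rmorphD !rmorphM !rmorphD.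
by move: (emb k0) (emb k1) (emb k2) (emb A1) (emb W) (emb S) => *; ring.
Qed.

Lemma integral_basis_of_maximal :
  (forall P b c, irreducible_poly P ->
     integralOver emb (scaled_combination P b c) -> P %| b /\ P %| c) ->
  let basis := [tuple 1; omega + emb S; quadratic_generator] in
  (forall u, u \in L /\ integralOver emb u <->
     exists k : 'I_3 -> {poly F}, u = \sum_i emb (k i) * tnth basis i) /\
  (forall k : 'I_3 -> {poly F},
     \sum_i emb (k i) * tnth basis i = 0 -> forall i, k i = 0).
Proof.
move=> locP basis; split=> [u|k]; last first.
  rewrite sum_basisE embE => /tracefree_indep[k0 k1 k2].
  have {}k2 : k (inord 2) = 0.
    move/eqP: k2; rewrite mulf_eq0 invr_eq0 !iota_eq0 (negPf I_neq0) orbF.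
    by move/eqP.
  have {}k1 : k 1 = 0.
    move/eqP: k1; rewrite k2 mul0r addr0 mulf_eq0 invr_eq0 !iota_eq0.
    by rewrite mulf_eq0 (negPf I_neq0) !orbF => /eqP.
  move/eqP: k0; rewrite iota_eq0 k1 k2 !mul0r !addr0 => /eqP k0 i.
  case: i => [[|[|[|i]]] lti] //.
  - by rewrite -[RHS]k0; congr k; apply/val_inj.
  - by rewrite -[RHS]k1; congr k; apply/val_inj.
  - by rewrite -[RHS]k2; congr k; apply/val_inj; rewrite /= inordK.
split=> [[uL intu]|[k ->]]; last first.
  rewrite sum_basisE; split; first by rewrite rpredD ?polyin_in_L ?tracefree_in_L.
  by apply: integral_add; [apply: integral_id | apply: integral_combination].
have [s [x [y uE]]] := span_L uL; rewrite uE in intu *.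
have [s' sE] := integral_trace intu.
have {}intu : integralOver emb (tracefree x y).
  have -> : tracefree x y = s%:A + tracefree x y - emb s'.
    by rewrite embE -sE addrC addKr.
  exact: integral_sub intu (integral_id _ _).
(* Solving x = (b I + c T) / (D I) and y = c / (D I) gives b / D = x - y T and c / D = y I; [D] is
   the product of the two denominators. *)
have [n1 [d1 [d10 xE]]] := iota_frac (x - y * iota T).
have [n2 [d2 [d20 yE]]] := iota_frac (y * iota I).
have I0 : iota I != 0 by rewrite iota_eq0.
have D0 : d1 * d2 != 0 by rewrite mulf_neq0.
have e : tracefree x y = scaled_combination (d1 * d2) (n1 * d2) (n2 * d1).
  rewrite scaled_combinationE //.
  have yE' : y = iota (n2 * d1) / iota (d1 * d2 * I).
    rewrite -[LHS](mulfK I0) yE !rmorphM; move: d10 d20; rewrite -!iota_eq0.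
    move: (iota d1) (iota d2) (iota n2) (iota I) I0 => d1' d2' n2' I' *; field.
  exact/and3P.
  rewrite -yE'; congr (tracefree _ _).
  rewrite -[LHS](subrK (y * iota T)) xE yE' rmorphD !rmorphM.
  move: d10 d20; rewrite -!iota_eq0.
  move: (iota d1) (iota d2) (iota n2) (iota n1) (iota T) (iota I) I0.
  move=> d1' d2' n2' n1' T' I' *; field.
  exact/and3P.
have := denominator_dvd locP D0; rewrite e in intu *.
move=> /(_ _ _ intu)[/dvdpP[b bE] /dvdpP[c cE]].
exists (fun i => [:: s' - b * S - c * (A1 + W); b; c]`_i).
rewrite sum_basisE /= inordK //= sE -embE; congr (emb _ + _).
  by ring.
by rewrite /scaled_combination bE cE ![_ * (d1 * d2)]mulrC combinationM mulKf ?emb_eq0.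
Qed.

Lemma maximal_at_dvd P b c : irreducible_poly P -> maximal_at M H I T P ->
  integralOver emb (scaled_combination P b c) -> P %| b /\ P %| c.
Proof.
move=> irrP; have I20 : I ^+ 2 != 0 by rewrite expf_neq0.
case=> [nPD|t1 t2 nPM nPt Pl Pw nPw|I' T' H' M' IE nPI TE HE nPH ME
  |H' M' nPI HE nPH ME].
- apply: maximal_of_disc => //; apply: contra nPD => PD.
  have -> : H ^+ 2 - 4%:R * M ^+ 3 = (B ^+ 2 - 4%:R * M * C) * I ^+ 2.
    transitivity ((I * B) ^+ 2 - 4%:R * M * (I ^+ 2 * C)); last by ring.
    by rewrite -mixed_coefE -last_coefE; ring.
  by rewrite dvdp_mul2r.
- have wE : hess M H (I * t1 + T * t2) t2 =
      I ^+ 2 * (M * t1 ^+ 2 + B * t1 * t2 + C * t2 ^+ 2).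
    by rewrite [I * t1]mulrC [T * t2]mulrC hessE.
  apply: (@maximal_of_simple_value _ t1 t2) => //.
  + rewrite -(dvdp_mul2l _ _ I_neq0) [I * P]mulrC.
    suff -> : I * (2%:R * M * t1 + B * t2) =
      2%:R * M * (I * t1) + (2%:R * M * T + H) * t2 by [].
    by rewrite mixed_coefE; ring.
  + by rewrite -(dvdp_mul2l _ _ I20) -wE mulrC.
  + by rewrite -(dvdp_mul2l _ _ I20) -wE mulrC.
- exact: (maximal_at_beta1 (I' := I') (T' := T') (H' := H') (M' := M')).
- exact: (maximal_at_beta2 (H' := H') (M' := M')).
Qed.

Lemma integral_basis_of_maximal_at :
  (forall P, finite_place P -> maximal_at M H I T P) ->
  let basis := [tuple 1; omega + emb S; quadratic_generator] in
  (forall u, u \in L /\ integralOver emb u <->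
     exists k : 'I_3 -> {poly F}, u = \sum_i emb (k i) * tnth basis i) /\
  (forall k : 'I_3 -> {poly F},
     \sum_i emb (k i) * tnth basis i = 0 -> forall i, k i = 0).
Proof.
move=> maxP; apply: integral_basis_of_maximal => P b c irrP intu.
have [Q fpQ PQ] := monic_associate irrP.
have [r PE] : exists r, P = r * Q by apply/dvdpP; rewrite (eqp_dvdr _ PQ).
rewrite !(eqp_dvdl _ PQ); apply: (maximal_at_dvd fpQ.2 (maxP Q fpQ)).
have r0 : emb r != 0.
  by rewrite emb_eq0; apply: contraNneq (irredp_neq0 irrP) => r0; rewrite PE r0 mul0r.
have -> : scaled_combination Q b c = emb r * scaled_combination P b c.
  by rewrite /scaled_combination PE rmorphM invfM -mulrA mulVKf.
by apply: integral_mul intu; apply: integral_id.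
Qed.

End CubicExtension.

Lemma integral_basis_cubic (F : fieldType) (Omega : splittingFieldType (ratfun F))
    (L : {subfield Omega}) (omega : Omega) (M H I S T V : {poly F}) :
  3%:R != 0 :> F -> \dim L = 3%N -> <<1; omega>>%VS = L ->
  omega ^+ 3 = 3%:R * polyin Omega M * omega + polyin Omega H ->
  I != 0 -> I %| T ^+ 2 - M -> I ^+ 2 %| T ^+ 3 - 3%:R * M * T - H ->
  I %| V - (T ^+ 2 - 3%:R * M) ->
  (forall P, finite_place P -> maximal_at M H I T P) ->
  integral_basis L
    [tuple 1; omega + polyin Omega S;
      (polyin Omega I)^-1
        * (omega ^+ 2 + polyin Omega T * omega + polyin Omega V)].
Proof.
move=> three_neq0 dimL genL omega3 I0.
move=> /dvdpP[A1 A1E] /dvdpP[B1 B1E] /dvdpP[W WE] maxP.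
have VE : V = T ^+ 2 - 3%:R * M + I * W by rewrite [I * W]mulrC -WE addrC subrK.
rewrite [A1 * I]mulrC in A1E; rewrite [B1 * _]mulrC in B1E.
have iota_inj : injective (@FracField.tofrac {poly F}).
  by move=> f g /eqP; rewrite tofrac_eq => /eqP.
have iota_frac (x : ratfun F) : exists n d, d != 0 /\ x = n%:F / d%:F.
  by have [n [d [d0 _ xE]]] := frac_coprime x; exists n, d.
have := @integral_basis_of_maximal_at F (ratfun F) Omega (@FracField.tofrac _)
  (@polyin F Omega) (fun f => erefl) iota_inj (@integral_ratfun F Omega) L omega M H
  three_neq0 dimL genL omega3 iota_frac I T W A1 B1 I0 A1E B1E S maxP.
by rewrite /quadratic_generator -VE.
Qed.

(** * Discriminant, congruences and Hasse's normal form *)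

Lemma quadratic_clear_denominator (K : fieldType) (h k x N D : K) :
  D != 0 -> x = N / D -> x ^+ 2 + h * x + k = 0 ->
  N ^+ 2 + h * N * D + k * D ^+ 2 = 0.
Proof.
move=> D0 -> e; rewrite -[RHS](mulr0 (D ^+ 2)) -e.
by field.
Qed.

(** With r0 = M n / d the resolvent equation becomes M hess(n, d) = -H^2 d^2. Now [alpha ^+ 2]
    divides [H ^+ 2] and is coprime to [M]. *)
Lemma resolvent_hess (F : fieldType) (Omega : splittingFieldType (ratfun F))
    (alpha beta1 beta2 gamma n d : {poly F}) (r0 : ratfun F)
    (M := (gamma * beta1 * beta2) ^+ 2) (H := alpha * beta1 ^+ 2 * beta2) :
  coprimep alpha M -> M != 0 -> d != 0 ->
  resolvent_root alpha beta1 beta2 gamma (r0%:A : Omega) ->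
  r0 / (gamma ^+ 2 * beta1 ^+ 2 * beta2 ^+ 2)%:F = n%:F / d%:F ->
  alpha ^+ 2 %| hess M H n d.
Proof.
move=> copM M0 d0 rr r0E; have cop2 : coprimep (alpha ^+ 2) M by rewrite coprimep_expl.
have ME : gamma ^+ 2 * beta1 ^+ 2 * beta2 ^+ 2 = M by rewrite /M; ring.
have {}r0E : r0 = (M * n)%:F / d%:F.
  have M0F : M%:F != 0 by rewrite tofrac_eq0.
  by rewrite tofracM -mulrA -r0E ME mulrC divfK.
have {}rr : r0 ^+ 2 + H%:F * r0 + (M ^+ 3 + H ^+ 2)%:F = 0.
  apply: (fmorph_inj (in_alg Omega)); rewrite rmorph0 -[RHS]rr /=.
  rewrite !algD algX algM /polyin.
  congr (_ + (_%:F)%:A); rewrite /M /H; ring.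
have d0F : d%:F != 0 by rewrite tofrac_eq0.
have := quadratic_clear_denominator d0F r0E rr.
rewrite -!tofracXn -!tofracM -!tofracD => /eqP; rewrite tofrac_eq0 => /eqP e.
rewrite -(Gauss_dvdpr _ cop2); apply/dvdpP;
  exists (- (beta1 ^+ 4 * beta2 ^+ 2 * d ^+ 2)).
apply: (eq_of_sub _ e); rewrite /hess /H; ring.
Qed.

(** At t = al c / (ga^2 b2) the form hess(t, 1) equals (b1 al / ga)^2 times the Artin-Schreier
    expression c^2 + c + ga^6 b1^2 b2^4 / al^2. The term [J ^+ 2] removes the final 1 in the
    definition of [g]. *)
Lemma hess_of_hasse_field (K : fieldType)
    (al aI J b1 b2 ga n d c g : K) :
  al = aI * J -> al != 0 -> d != 0 -> ga ^+ 2 * b2 != 0 ->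
  al * c / (ga ^+ 2 * b2) = n / d ->
  J ^+ 2 * (c ^+ 2 + c + (ga ^+ 6 * b1 ^+ 2 * b2 ^+ 4) / al ^+ 2 + 1) = g ->
  ga ^+ 2 * hess ((ga * b1 * b2) ^+ 2) (al * b1 ^+ 2 * b2) n d =
    b1 ^+ 2 * d ^+ 2 * aI ^+ 2 * (g - J ^+ 2).
Proof.
move=> alE al0 d0 gb0 cE <-; have {cE} -> : c = n * (ga ^+ 2 * b2) / (d * al).
  rewrite -[LHS](mulfK al0) [c * al]mulrC -[al * c](divfK gb0) cE.
  by field; rewrite al0.
move: al0; rewrite alE mulf_eq0 negb_or => /andP[aI0 J0].
by rewrite /hess; field; apply/and3P.
Qed.

Lemma hess_of_hasse (F : fieldType)
    (alpha alphaI J beta1 beta2 gamma n d g : {poly F}) (c : ratfun F)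
    (M := (gamma * beta1 * beta2) ^+ 2) (H := alpha * beta1 ^+ 2 * beta2) :
  alpha = alphaI * J -> alpha != 0 -> d != 0 -> gamma ^+ 2 * beta2 != 0 ->
  alpha%:F * c / (gamma ^+ 2 * beta2)%:F = n%:F / d%:F ->
  (J ^+ 2)%:F * (c ^+ 2 + c
    + (gamma ^+ 6 * beta1 ^+ 2 * beta2 ^+ 4)%:F / (alpha ^+ 2)%:F + 1) = g%:F ->
  gamma ^+ 2 * hess M H n d =
    beta1 ^+ 2 * d ^+ 2 * alphaI ^+ 2 * (g - J ^+ 2).
Proof.
have gbE : (gamma ^+ 2 * beta2)%:F = gamma%:F ^+ 2 * beta2%:F.
  by rewrite tofracM tofracXn.
move=> alphaE a0 d0 gb0 cE gE.
have ME : M%:F = (gamma%:F * beta1%:F * beta2%:F) ^+ 2.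
  by rewrite tofracXn tofracM tofracM.
have HE : H%:F = alpha%:F * beta1%:F ^+ 2 * beta2%:F.
  by rewrite tofracM tofracM tofracXn.
have EE : (gamma ^+ 6 * beta1 ^+ 2 * beta2 ^+ 4)%:F =
    gamma%:F ^+ 6 * beta1%:F ^+ 2 * beta2%:F ^+ 4.
  by rewrite tofracM tofracM !tofracXn.
apply/eqP; rewrite -tofrac_eq; apply/eqP.
rewrite tofracM tofracXn rmorph_hess /= ME HE.
rewrite [RHS]tofracM [X in _ = X * _]tofracM [X in _ = X * _ * _]tofracM.
rewrite tofracB !tofracXn.
apply: (hess_of_hasse_field (aI := alphaI%:F) (J := J%:F) (c := c)).
- by rewrite alphaE tofracM.
- by rewrite tofrac_eq0.
- by rewrite tofrac_eq0.
- by rewrite -gbE tofrac_eq0.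
- by rewrite -gbE.
- by rewrite -gE EE !tofracXn.
Qed.

(** * The cofactor of [alphaI] in [alpha] *)

Section Cofactor.

Variables (F : fieldType) (alpha alphaI : {poly F}) (s : seq {poly F}).
Variable ell : {poly F} -> int.
Hypothesis alpha_fact : factorization alpha s.
Hypothesis alphaI_eq : alphaI_spec alpha s ell alphaI.
Hypothesis ell_ge : forall P, P \in s -> 0 <= ((ell P + 1) %/ 2)%Z.

Let e P := `|((ell P + 1) %/ 2)%Z|%N.

(** The exponents in [alphaI_spec] are integers; [ell_ge] turns those of the quotient alpha / alphaI
    into natural numbers [e P], so the quotient is a polynomial. *)
Lemma cofactor_exists : exists2 k, k != 0 &
  alpha = alphaI * (k *: \prod_(P <- s) P ^+ e P).
Proof.
case: alpha_fact => us sP [k k0 alphaE]; exists k => //.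
rewrite -scalerAr [LHS]alphaE; congr (_ *: _).
apply/eqP; rewrite -tofrac_eq tofracM alphaI_eq !rmorph_prod -big_split /=.
apply/eqP; apply: eq_big_seq => P Ps.
have P0 : P%:F != 0 by rewrite tofrac_eq0 irredp_neq0 //; case: (sP P Ps) => -[].
rewrite !tofracXn !exprnP -expfzDr // gez0_abs ?ell_ge // subrK //.
Qed.

Lemma vpoly_cofactor P k : k != 0 -> P \in s ->
  vpoly P (k *: \prod_(Q <- s) Q ^+ e Q) = e P.
Proof.
move=> k0 Ps; case: alpha_fact => us sP _.
have [fpP _] := sP P Ps; have irrP := fpP.2.
rewrite (bigD1_seq P) //= scalerAr vpoly_unique //.
rewrite dvdpZr // big_seq_cond; elim/big_rec: _ => [|Q f].
  by rewrite irredp_not_dvd1 ?size_poly1.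
move=> /andP[Qs QP] nPf; rewrite irredp_dvdM // negb_or nPf andbT.
apply: contra QP => /(irredp_dvdX irrP) PQ; apply/eqP/esym.
exact: finite_place_dvd fpP (sP Q Qs).1 PQ.
Qed.

Lemma finite_place_in_fact P : finite_place P -> P %| alpha -> P \in s.
Proof.
move=> fpP; case: alpha_fact => us sP [k k0 ->]; rewrite dvdpZr //.
have irrP := fpP.2; rewrite big_seq; elim/big_rec: _ => [|Q f Qs IH].
  by rewrite (negPf (irredp_not_dvd1 irrP _)) ?size_poly1.
rewrite irredp_dvdM // => /orP[/(irredp_dvdX irrP) PQ|//].
by rewrite (finite_place_dvd fpP (sP Q Qs).1 PQ).
Qed.

End Cofactor.

(** * Divisibility conditions and maximality in terms of alpha, beta and gamma *)

Section Arithmetic.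

Variable F : fieldType.
Variables alpha beta beta1 beta2 gamma : {poly F}.
Hypothesis alpha_coprime : coprimep alpha (beta * gamma).
Hypothesis beta_cubefree : power_free 3 beta.
Hypothesis betaE : beta = beta1 * beta2 ^+ 2.
Hypothesis beta1_sqfree : power_free 2 beta1.
Hypothesis beta2_sqfree : power_free 2 beta2.

Let M := (gamma * beta1 * beta2) ^+ 2.
Let H := alpha * beta1 ^+ 2 * beta2.

Lemma coprime_beta1 : coprimep alpha beta1.
Proof. by move: alpha_coprime; rewrite betaE !coprimepMr => /andP[/andP[]]. Qed.

Lemma coprime_beta2 : coprimep alpha beta2.
Proof.
by move: alpha_coprime; rewrite betaE !coprimepMr => /andP[/andP[_ /andP[]]].
Qed.

Lemma coprime_gamma : coprimep alpha gamma.
Proof. by move: alpha_coprime; rewrite coprimepMr => /andP[]. Qed.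

Lemma beta1_not_beta2 P : irreducible_poly P -> P %| beta1 -> ~~ (P %| beta2).
Proof.
move=> irrP P1; apply: contra (beta_cubefree (irredp_size_neq1 irrP)) => P2.
by rewrite betaE exprS dvdp_mul // dvdp_exp2r.
Qed.

(** [P] divides exactly one of [beta1], [beta2] because [beta] is cube-free, and only once because
    they are square-free; these are the two tame alternatives of [maximal_at]. *)
Lemma maximal_at_beta P J T : irreducible_poly P ->
  coprimep J (beta * gamma) -> beta1 %| T -> (P %| beta1) || (P %| beta2) ->
  maximal_at M H (beta1 * J) T P.
Proof.
move=> irrP copJ /dvdpP[T1 TE] /orP[]/dvdpP[f fE].
- have P1 : P %| beta1 by rewrite fE dvdp_mulIr.
  have nP2 := beta1_not_beta2 irrP P1.
  have nPf : ~~ (P %| f).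
    apply: contra (beta1_sqfree (irredp_size_neq1 irrP)) => Pf.
    by rewrite fE expr2 dvdp_mul.
  have Pb : P %| beta * gamma by rewrite betaE -mulrA dvdp_mulr.
  have nPJ : ~~ (P %| J) by apply: irredp_coprime_dvd Pb => //; rewrite coprimep_sym.
  have nPa : ~~ (P %| alpha).
    by apply: irredp_coprime_dvd Pb => //; rewrite coprimep_sym.
  apply: (@MaximalBeta1 _ _ _ _ _ _ (f * J) (f * T1) (alpha * f ^+ 2 * beta2)
            ((gamma * f * beta2) ^+ 2)).
  + by rewrite fE; ring.
  + by rewrite irredp_dvdM // negb_or nPf.
  + by rewrite TE fE; ring.
  + by rewrite /H fE; ring.
  + by rewrite !irredp_dvdM // !negb_or nPa nP2 nPf.
  + by rewrite /M fE; ring.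
- have P2 : P %| beta2 by rewrite fE dvdp_mulIr.
  have nP1 : ~~ (P %| beta1) by apply: contraL P2; apply: beta1_not_beta2.
  have nPf : ~~ (P %| f).
    apply: contra (beta2_sqfree (irredp_size_neq1 irrP)) => Pf.
    by rewrite fE expr2 dvdp_mul.
  have Pb : P %| beta * gamma by rewrite betaE expr2 dvdp_mulr // dvdp_mull // dvdp_mull.
  have nPJ : ~~ (P %| J) by apply: irredp_coprime_dvd Pb => //; rewrite coprimep_sym.
  have nPa : ~~ (P %| alpha).
    by apply: irredp_coprime_dvd Pb => //; rewrite coprimep_sym.
  apply: (@MaximalBeta2 _ _ _ _ _ _ (alpha * beta1 ^+ 2 * f)
            ((gamma * beta1 * f) ^+ 2)).
  + by rewrite irredp_dvdM // negb_or nP1.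
  + by rewrite /H fE; ring.
  + by rewrite !irredp_dvdM // !negb_or nPa nPf nP1.
  + by rewrite /M fE; ring.
Qed.

(** [beta1] and [J] are coprime, so the conditions split; those at [beta1] are automatic, since
    [beta1] divides [T] and [beta1 ^+ 2] divides [M] and [H]. *)
Lemma modulus_dvd J T : coprimep J (beta * gamma) -> beta1 %| T ->
  J %| T ^+ 2 - M -> J ^+ 2 %| T ^+ 3 - 3%:R * M * T - H ->
  beta1 * J %| T ^+ 2 - M /\
  (beta1 * J) ^+ 2 %| T ^+ 3 - 3%:R * M * T - H.
Proof.
move=> copJ /dvdpP[T1 ->] JA JB.
have cop : coprimep beta1 J.
  by move: copJ; rewrite betaE !coprimepMr coprimep_sym => /andP[/andP[]].
have cop2 : coprimep (beta1 ^+ 2) (J ^+ 2) by rewrite coprimep_expl ?coprimep_expr.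
split; [rewrite Gauss_dvdp // JA andbT | rewrite exprMn Gauss_dvdp // JB andbT].
- apply/dvdpP; exists (T1 ^+ 2 * beta1 - gamma ^+ 2 * beta1 * beta2 ^+ 2).
  by rewrite /M; ring.
- apply/dvdpP; exists (T1 ^+ 3 * beta1
    - 3%:R * (gamma ^+ 2 * beta1 * beta2 ^+ 2) * T1 - alpha * beta2).
  by rewrite /M /H; ring.
Qed.

(** [eqmodf] allows a fraction [A / B] not in lowest terms; the reduced denominator divides [B] and
    so remains invertible modulo [I]. *)
Lemma eqmodf_coprime (I T : {poly F}) (k : ratfun F) : eqmodf I T k ->
  exists n d, [/\ d != 0, coprimep n d, k = n%:F / d%:F, coprimep I d
                & I %| n - T * d].
Proof.
case=> A [B [U [B0 kE BU TAU]]]; have [n [d [d0 cop kE']]] := frac_coprime k.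
have nBE : n * B = A * d.
  apply/eqP; rewrite -tofrac_eq !rmorphM -eqr_div ?tofrac_eq0 //.
  by rewrite -kE' kE.
have copIB : coprimep I B.
  have /dvdpP[Q QE] := BU; have : coprimep I (B * U).
    by rewrite -(subrK 1 (B * U)) QE coprimep_addl_mul coprimep1.
  by rewrite coprimepMr => /andP[].
have dB : d %| B.
  by rewrite -(Gauss_dvdpr _ (_ : coprimep d n)) 1?coprimep_sym // nBE dvdp_mulIr.
exists n, d; split=> //; first exact: coprimep_dvdl dB copIB.
rewrite -(Gauss_dvdpl _ copIB); have -> : (n - T * d) * B =
    A * d * (1 - B * U) + (A * U - T) * (B * d) .
  by rewrite mulrBl nBE; ring.
have BU' : I %| 1 - B * U by rewrite -opprB dvdpNr.
have TAU' : I %| A * U - T by rewrite -opprB dvdpNr.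
by apply: dvdp_add; [apply: dvdp_mull | apply: dvdp_mulr].
Qed.

(** * Characteristic different from 2 *)

Section Odd.

Variables eta1 eta2 T : {poly F}.
Hypothesis two_neq0 : 2%:R != 0 :> F.
Hypothesis etaE :
  4%:R * gamma ^+ 6 * beta ^+ 2 - alpha ^+ 2 = eta1 * eta2 ^+ 2.
Hypothesis eta1_sqfree : power_free 2 eta1.
Hypothesis T_eta : eqmodf (eta2 ^+ 2) T
  (- (alpha%:F / (2%:R * gamma ^+ 2 * beta2)%:F)).
Hypothesis eta2_neq0 : eta2 != 0.
Hypothesis beta1_neq0 : beta1 != 0.
Hypothesis gamma_neq0 : gamma != 0.
Hypothesis beta2_neq0 : beta2 != 0.

Lemma natr_dvd n (f g : {poly F}) : n%:R != 0 :> F -> (f %| n%:R * g) = (f %| g).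
Proof. by move=> n0; rewrite -polyC_natr mul_polyC dvdpZr. Qed.

Lemma four_neq0 : 4%:R != 0 :> F.
Proof. by rewrite (natrM _ 2 2) mulf_neq0. Qed.

(** Modulo [beta * gamma] the product [eta1 * eta2 ^+ 2] is [- alpha ^+ 2], which is invertible. *)
Lemma odd_coprime : coprimep eta2 (beta * gamma).
Proof.
have : coprimep (beta * gamma) (alpha ^+ 2) by rewrite coprimep_sym coprimep_expl.
have -> : alpha ^+ 2 =
    (4%:R * gamma ^+ 5 * beta) * (beta * gamma) + (- (eta1 * eta2 ^+ 2)).
  by rewrite -etaE; ring.
rewrite coprimep_addl_mul -scaleN1r coprimepZr ?oppr_eq0 ?oner_neq0 //.
by rewrite coprimepMr coprimep_pexpr // [_ eta2]coprimep_sym => /andP[].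
Qed.

Lemma odd_dvd_linear : eta2 ^+ 2 %| 2%:R * gamma ^+ 2 * beta2 * T + alpha.
Proof.
have [n [d [d0 cop kE copd dT]]] := eqmodf_coprime T_eta.
have D0 : 2%:R * gamma ^+ 2 * beta2 != 0.
  by rewrite !mulf_neq0 ?expf_neq0 // -polyC_natr polyC_eq0.
have nE : n * (2%:R * gamma ^+ 2 * beta2) = - alpha * d.
  apply/eqP; rewrite -tofrac_eq [X in X == _]tofracM [X in _ == X]tofracM.
  rewrite -eqr_div ?tofrac_eq0 //.
  by rewrite -kE tofracN mulNr.
rewrite -(Gauss_dvdpl _ copd) -dvdpNr.
have -> : - ((2%:R * gamma ^+ 2 * beta2 * T + alpha) * d) =
   (n - T * d) * (2%:R * gamma ^+ 2 * beta2).
  by rewrite mulrBl nE; ring.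
exact: dvdp_mulr.
Qed.

Lemma odd_dvd_quadratic : eta2 ^+ 2 %| T ^+ 2 - M.
Proof.
have := odd_coprime; rewrite betaE !coprimepMr.
move=> /andP[/andP[_ /andP[cop2 _]] copg].
have cop : coprimep (eta2 ^+ 2) (gamma ^+ 4 * beta2 ^+ 2).
  by rewrite coprimep_expl // coprimepMr !coprimep_expr.
rewrite -(Gauss_dvdpr _ cop) -(natr_dvd _ _ four_neq0).
set e := 2%:R * gamma ^+ 2 * beta2 * T + alpha.
(* Completing the square: (e - alpha)^2 - 4 gamma^6 beta^2, where the definition of [eta1] and
   [eta2] replaces the difference of squares. *)
have -> : 4%:R * (gamma ^+ 4 * beta2 ^+ 2 * (T ^+ 2 - M)) =
    e * (e - 2%:R * alpha) - eta1 * eta2 ^+ 2.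
  by rewrite -etaE betaE /e /M; ring.
by rewrite dvdp_sub ?dvdp_mulIr // dvdp_mulr // odd_dvd_linear.
Qed.

Lemma odd_dvd_cubic : eta2 ^+ 2 %| T ^+ 3 - 3%:R * M * T - H.
Proof.
(* The remainder 2 M T + H is beta1^2 beta2 times the linear expression already known to be
   divisible. *)
have -> : T ^+ 3 - 3%:R * M * T - H = T * (T ^+ 2 - M)
    - beta1 ^+ 2 * beta2 * (2%:R * gamma ^+ 2 * beta2 * T + alpha).
  by rewrite /M /H; ring.
by rewrite dvdp_sub // dvdp_mull // ?odd_dvd_quadratic ?odd_dvd_linear.
Qed.

Lemma odd_maximal_at P : irreducible_poly P ->
  ~~ (P %| beta1) -> ~~ (P %| beta2) -> maximal_at M H (beta1 * eta2) T P.
Proof.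
move=> irrP nP1 nP2; apply: MaximalDisc.
apply: contra (eta1_sqfree (irredp_size_neq1 irrP)).
have -> : H ^+ 2 - 4%:R * M ^+ 3 =
    - (beta1 ^+ 2 * beta2 ^+ 2 * eta1) * (beta1 * eta2) ^+ 2.
  transitivity (- (beta1 ^+ 4 * beta2 ^+ 2 * (eta1 * eta2 ^+ 2))); last by ring.
  by rewrite -etaE betaE /M /H; ring.
rewrite dvdp_mul2r ?expf_neq0 ?mulf_neq0 // dvdpNr Gauss_dvdpr //.
by rewrite coprimep_expl // coprimepMr !coprimep_expr ?irredp_coprime.
Qed.

End Odd.

(** * Characteristic 2 *)

Section Even.

Variables alphaI J T n d w : {poly F}.
Hypothesis two_eq0 : 2%:R = 0 :> F.
Hypothesis alpha_neq0 : alpha != 0.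
Hypothesis beta1_neq0 : beta1 != 0.
Hypothesis alphaE : alpha = alphaI * J.
Hypothesis coprime_nd : coprimep n d.
Hypothesis coprime_d : coprimep alphaI d.
Hypothesis T_alphaI : alphaI %| n - T * d.
Hypothesis hess_nd : hess M H n d = alphaI ^+ 2 * w.

Lemma poly_two_eq0 : 2%:R = 0 :> {poly F}.
Proof. by rewrite -polyC_natr two_eq0 polyC0. Qed.

Lemma even_coprime : coprimep alphaI (beta * gamma).
Proof. by apply: coprimep_dvdr alpha_coprime; rewrite alphaE dvdp_mulIl. Qed.

Lemma coprime_M : coprimep alpha M.
Proof.
rewrite coprimep_expr // !coprimepMr.
by rewrite coprime_gamma coprime_beta1 coprime_beta2.
Qed.

Lemma coprime_alphaI_M : coprimep alphaI M.
Proof. by apply: coprimep_dvdr coprime_M; rewrite alphaE dvdp_mulIl. Qed.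

(** Replacing [n] by [T * d] shifts it by a multiple t alphaI. The mixed term carrying [M] vanishes
    with 2, and the one carrying [H] gains a second factor [alphaI] from [alpha]. *)
Lemma even_dvd_hess : alphaI ^+ 2 %| hess M H T 1.
Proof.
have /dvdpP[t tE] := T_alphaI.
have nE : n = T * d + t * alphaI by rewrite -tE addrC subrK.
have cop : coprimep (alphaI ^+ 2) (d ^+ 2) by rewrite coprimep_expl // coprimep_expr.
rewrite -(Gauss_dvdpl _ cop); apply/dvdpP.
exists (w - M * t ^+ 2 - J * beta1 ^+ 2 * beta2 * t * d).
have e : alphaI ^+ 2 * w - hess M H n d = 0 by rewrite hess_nd subrr.
have HE : H = alphaI * J * beta1 ^+ 2 * beta2 by rewrite /H alphaE.
rewrite -[LHS]addr0 -e nE /hess HE.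
have := poly_two_eq0; move: M => M' two0.
transitivity (2%:R * (- M' * T * d * t * alphaI)
  + (w - M' * t ^+ 2 - J * beta1 ^+ 2 * beta2 * t * d) * alphaI ^+ 2); first by ring.
by rewrite two0 mul0r add0r.
Qed.

Lemma even_dvd_quadratic : alphaI %| T ^+ 2 - M.
Proof.
rewrite -(Gauss_dvdpr _ coprime_alphaI_M).
have -> : M * (T ^+ 2 - M) =
    hess M H T 1 - alphaI * (J * beta1 ^+ 2 * beta2 * T) - 2%:R * M ^+ 2.
  by rewrite /hess /H alphaE; move: M => M'; ring.
rewrite poly_two_eq0 mul0r subr0 dvdp_sub ?dvdp_mulIl //.
by apply: dvdp_trans even_dvd_hess; rewrite expr2 dvdp_mulIl.
Qed.

(** Up to multiples of 2, [M] times the cubic is T hess(T, 1) - H (T^2 - M), and [alphaI] divides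
    both [H] and [T ^+ 2 - M]. *)
Lemma even_dvd_cubic : alphaI ^+ 2 %| T ^+ 3 - 3%:R * M * T - H.
Proof.
have cop : coprimep (alphaI ^+ 2) M by rewrite coprimep_expl // coprime_alphaI_M.
rewrite -(Gauss_dvdpr _ cop).
have -> : M * (T ^+ 3 - 3%:R * M * T - H) = T * hess M H T 1
    - alphaI * (T ^+ 2 - M) * (J * beta1 ^+ 2 * beta2)
    - 2%:R * (M * H + 2%:R * M ^+ 2 * T).
  by rewrite /hess /H alphaE; move: M => M'; ring.
have a0 : alphaI != 0 by apply: contraNneq alpha_neq0 => e; rewrite alphaE e mul0r.
rewrite poly_two_eq0 mul0r subr0.
apply: dvdp_sub; first by apply: dvdp_mull even_dvd_hess.
by apply: dvdp_mulr; rewrite expr2 dvdp_mul2l ?even_dvd_quadratic.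
Qed.

(** If [P] divided [d], then hess(n, d) would be M n^2 modulo [P], so [P] would divide [n] as
    well. *)
Lemma even_not_dvd_d P : irreducible_poly P -> P %| alpha -> P %| w ->
  ~~ (P %| d).
Proof.
move=> irrP Pa Pw; have nPM := irredp_coprime_dvd irrP coprime_M Pa.
apply/negP => Pd; have /negP[] : ~~ (P %| n).
  by apply: irredp_coprime_dvd Pd; rewrite // coprimep_sym.
have : P %| M * n ^+ 2.
  have -> : M * n ^+ 2 = alphaI ^+ 2 * w - d * (H * n + M ^+ 2 * d).
    by rewrite -hess_nd /hess; move: M H => M' H'; ring.
  by apply: dvdp_sub; [exact: dvdp_mull | exact: dvdp_mulr].
by rewrite irredp_dvdM // (negPf nPM) => /(irredp_dvdX irrP).
Qed.

Lemma even_maximal_at P : irreducible_poly P ->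
  ~~ (P %| beta1) -> ~~ (P %| beta2) ->
  (P %| J -> P %| w /\ ~~ (P ^+ 2 %| w)) ->
  maximal_at M H (beta1 * alphaI) T P.
Proof.
move=> irrP nP1 nP2 Pw.
have a0 : alphaI != 0 by apply: contraNneq alpha_neq0 => e; rewrite alphaE e mul0r.
have I0 : (beta1 * alphaI) ^+ 2 != 0 by rewrite expf_neq0 // mulf_neq0.
have [PJ|nPJ] := boolP (P %| J); last first.
  apply: MaximalDisc; apply: contra nPJ.
  have -> : H ^+ 2 - 4%:R * M ^+ 3 =
      beta1 ^+ 2 * beta2 ^+ 2 * J ^+ 2 * (beta1 * alphaI) ^+ 2
      - 2%:R * (2%:R * M ^+ 3).
    by rewrite /H alphaE; move: M => M'; ring.
  rewrite poly_two_eq0 mul0r subr0 dvdp_mul2r // Gauss_dvdpr ?dvdp_pexp2r //.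
  by rewrite coprimep_expl // coprimepMr !coprimep_expr ?irredp_coprime.
have [{}Pw nPw] := Pw PJ.
have Pa : P %| alpha by rewrite alphaE dvdp_mull.
have nPM : ~~ (P %| M) := irredp_coprime_dvd irrP coprime_M Pa.
have nPd := even_not_dvd_d irrP Pa Pw.
have /dvdpP[t tE] := T_alphaI.
have nE : n = T * d + t * alphaI by rewrite -tE addrC subrK.
have hE : hess M H (beta1 * alphaI * t + T * (d * beta1)) (d * beta1) =
    w * (beta1 * alphaI) ^+ 2.
  transitivity (beta1 ^+ 2 * (alphaI ^+ 2 * w)); last by ring.
  by rewrite -hess_nd nE /hess; move: M H => M' H'; ring.
apply: (@MaximalSimpleValue _ _ _ _ _ _ t (d * beta1)) => //.
- by rewrite irredp_dvdM // negb_or nPd.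
- rewrite poly_two_eq0 !mul0r !add0r /H alphaE.
  have -> : alphaI * J * beta1 ^+ 2 * beta2 * (d * beta1) =
    (J * (beta1 ^+ 2 * beta2 * d)) * (beta1 * alphaI) by ring.
  by rewrite dvdp_mul // dvdp_mulr.
- by rewrite hE dvdp_mul.
- by rewrite hE dvdp_mul2r.
Qed.

End Even.

(** * Data from Hasse's normal form in the non-Galois case *)

Lemma odd_succ_opp (v : int) : ~~ (2 %| v)%Z -> (2 %| - v + 1)%Z.
Proof.
move=> odd_v; have m1 : (v %% 2)%Z = 1.
  have := modz_ge0 v (isT : 2 != 0 :> int); have := ltz_pmod v (isT : 0 < 2 :> int).
  have : (v %% 2)%Z != 0 by apply: contraNneq odd_v => /dvdz_mod0P.
  by case: (v %% 2)%Z => [[|[|m]]|m].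
by apply/dvdzP; exists (- (v %/ 2)%Z); rewrite {1}(divz_eq v 2) m1; ring.
Qed.

(** Puts the Hasse data into the shape shared with the Galois case: [n / d] is the distinguished
    argument of [hess], and [w] is hess(n, d) / alphaI^2. *)
Lemma nongalois_data (Omega : splittingFieldType (ratfun F)) (r : Omega)
    (a : ratfun F) (I T : {poly F}) :
  alpha != 0 -> gamma != 0 -> beta2 != 0 ->
  even_nongalois_case r a alpha beta1 beta2 gamma I T ->
  exists alphaI J n d w : {poly F},
    [/\ I = beta1 * alphaI, beta1 %| T, alpha = alphaI * J, coprimep n d
      & coprimep alphaI d] /\
    [/\ alphaI %| n - T * d, hess M H n d = alphaI ^+ 2 * w
      & forall P, finite_place P -> ~~ (P %| beta1) -> P %| J ->
          P %| w /\ ~~ (P ^+ 2 %| w)].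
Proof.
move=> alpha0 gamma0 beta20 [b [ell [s [alphaI [c]]]]].
move=> [[hasse ellP fact aIE cP] [IE T1 TaI]].
have {hasse} [_ _ ram _] := hasse; have [_ sP _] := fact.
have ell_ge P : P \in s -> 0 <= ((ell P + 1) %/ 2)%Z.
  move=> /sP[fpP Pa]; apply: (@classic_EM (ramified <<1; r>>%AS P)) => -[Pr|nPr].
    rewrite divz_ge0 // (ellP P fpP Pa).1 // addr_ge0 // oppr_ge0 ltW //.
    by case: (ram P fpP Pr).
  by rewrite (ellP P fpP Pa).2 // addNr div0z.
have [k k0 alphaE] := cofactor_exists fact aIE ell_ge.
have vJ P (Ps : P \in s) := vpoly_cofactor ell fact k0 Ps.
set J := k *: _ in alphaE vJ.
have J0 : J != 0 by apply: contraNneq alpha0 => J0; rewrite alphaE J0 mulr0.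
have JF0 : (J ^+ 2)%:F != 0 by rewrite tofrac_eq0 expf_neq0.
have ram_value P : finite_place P -> P %| alpha -> ramified <<1; r>>%AS P ->
    (2 * vpoly P J)%N%:Z = ell P + 1.
  move=> fpP Pa Pr; have Ps := finite_place_in_fact fact fpP Pa.
  rewrite (vJ P Ps) PoszM gez0_abs ?ell_ge // mulrC divzK //.
  rewrite (ellP P fpP Pa).1 //; have [_ _ odd_v] := ram P fpP Pr.
  exact: odd_succ_opp.
have [D DE {}cP] : exists2 D, c ^+ 2 + c
    + (gamma ^+ 6 * beta1 ^+ 2 * beta2 ^+ 4)%:F / (alpha ^+ 2)%:F + 1 = D &
    forall P, finite_place P ->
      (P %| alpha /\ ramified <<1; r>>%AS P -> vfrac_eq P D (- ell P)) /\
      (~ (P %| alpha /\ ramified <<1; r>>%AS P) -> vfrac_ge0 P D).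
  by eexists; [reflexivity | exact: cP].
have J20 : J ^+ 2 != 0 by rewrite expf_neq0.
(* At a ramified [P] dividing [alpha], twice the valuation of [J] is [ell P + 1], one more than the
   pole order of [D]; at all other places [D] has no pole. *)
have [g gE] : exists g, (J ^+ 2)%:F * D = g%:F.
  apply: ratfun_poly => P fpP x0.
  have D0 : D != 0 by apply: contraNneq x0 => ->; rewrite mulr0.
  rewrite (vfracM fpP.2 JF0 D0) (vfrac_tofrac fpP.2 J20) (vpolyX 2 fpP.2 J0).
  have [Pa|nPa] := boolP (P %| alpha); last first.
    by rewrite addr_ge0 //; apply: (cP P fpP).2 => // -[Pa _]; rewrite Pa in nPa.
  apply: (@classic_EM (ramified <<1; r>>%AS P)) => -[Pr|nPr].
    by rewrite ram_value // ((cP P fpP).1 (conj Pa Pr)).2 addrAC subrr.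
  by rewrite addr_ge0 //; apply: (cP P fpP).2 => // -[].
have simple P : finite_place P -> P %| J -> (P %| g) && ~~ (P ^+ 2 %| g).
  move=> fpP PJ; have Pa : P %| alpha by rewrite alphaE dvdp_mull.
  have irrP := fpP.2; have sizeP := irredp_size_gt1 irrP.
  apply: (@classic_EM (ramified <<1; r>>%AS P)) => -[Pr|nPr]; last first.
    (* An unramified [P] has [ell P = -1], hence exponent 0 in [J], against [P %| J]. *)
    have Ps := finite_place_in_fact fact fpP Pa.
    have := dvd_vpoly 1 sizeP J0; rewrite expr1 PJ (vJ P Ps).
    by rewrite (ellP P fpP Pa).2 // addNr div0z.
  have [D0 vD] := (cP P fpP).1 (conj Pa Pr).
  have g0 : g != 0 by rewrite -tofrac_eq0 -gE; apply: mulf_neq0 JF0 D0.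
  suff [vg] : (vpoly P g)%:Z = 1.
    by rewrite -[P in P %| g]expr1 !dvd_vpoly // vg.
  rewrite -(vfrac_tofrac irrP g0) -gE (vfracM irrP JF0 D0).
  rewrite (vfrac_tofrac irrP J20) (vpolyX 2 irrP J0) ram_value // vD.
  by rewrite addrAC subrr add0r.
have [n [d [d0 cop_nd kE cop_d Tn]]] := eqmodf_coprime TaI.
have gb0 : gamma ^+ 2 * beta2 != 0 by rewrite mulf_neq0 ?expf_neq0.
have hE := hess_of_hasse alphaE alpha0 d0 gb0 kE (etrans (congr1 _ DE) gE).
have copIg : coprimep (alphaI ^+ 2) (gamma ^+ 2).
  rewrite coprimep_expl // coprimep_expr //.
  by apply: coprimep_dvdr coprime_gamma; rewrite alphaE dvdp_mulIl.
have /dvdpP[w wE] : alphaI ^+ 2 %| hess M H n d.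
  by rewrite -(Gauss_dvdpr _ copIg) hE dvdp_mulr // dvdp_mulIr.
rewrite mulrC in wE.
have aI0 : alphaI ^+ 2 != 0.
  by rewrite expf_neq0 //; apply: contraNneq alpha0 => e; rewrite alphaE e mul0r.
(* At a [P] dividing [J], [P ^+ 2] divides [J ^+ 2] and the other factors are units, so the
   valuation 1 of [g] passes to [w]. *)
have gwE : gamma ^+ 2 * w = beta1 ^+ 2 * d ^+ 2 * (g - J ^+ 2).
  apply: (mulfI aI0); rewrite mulrCA -wE hE; ring.
exists alphaI, J, n, d, w; split; split=> //.
  by move: T1; rewrite /eqmodp subr0.
move=> P fpP nP1 PJ; have irrP := fpP.2.
have /andP[Pg nPg] := simple P fpP PJ.
have Pa : P %| alpha by rewrite alphaE dvdp_mull.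
have nPgamma := irredp_coprime_dvd irrP coprime_gamma Pa.
have PJ2 : P ^+ 2 %| J ^+ 2 by rewrite dvdp_exp2r.
have Pw : P %| w.
  have : P %| gamma ^+ 2 * w.
    rewrite gwE dvdp_mull // dvdp_sub //; apply: dvdp_trans PJ2.
    by rewrite expr2 dvdp_mulIl.
  rewrite irredp_dvdM // => /orP[/(irredp_dvdX irrP)|//].
  by rewrite (negPf nPgamma).
split=> //; have nPd := even_not_dvd_d cop_nd wE irrP Pa Pw.
apply: contra nPg => Pw2.
have : P ^+ 2 %| beta1 ^+ 2 * d ^+ 2 * (g - J ^+ 2) by rewrite -gwE dvdp_mull.
rewrite Gauss_dvdpr ?dvdp_subl //.
by rewrite coprimep_expl // coprimepMr !coprimep_expr ?irredp_coprime.
Qed.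

End Arithmetic.

(** * Excluded values of [a], and assembly of the two characteristics *)

Lemma power_free_neq0 (F : fieldType) k (f : {poly F}) : power_free k f -> f != 0.
Proof.
move=> fk; apply: contraTneq (fk 0 _) => [->|]; last by rewrite size_poly0.
by rewrite dvdp0.
Qed.

Lemma natr_eq0_pchar (F : finFieldType) (p n l : nat) : prime p ->
  #|F| = (p ^ n)%N -> prime l -> l%:R = 0 :> F -> l = p.
Proof.
move=> pp cardF pl l0; have pF := card_finPcharP cardF pp.
have : l \in [pchar F] by rewrite inE pl l0 eqxx.
by rewrite (pcharf_eq pF) => /eqP.
Qed.

(** Excludes a = 2 or -2, for which the cubic has its roots in F(x); this keeps [eta2], hence [I],
    nonzero. *)
Lemma depressed_cubic_factor (R : comNzRingType) (y e : R) : e ^+ 2 = 1 ->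
  y ^+ 3 - 3%:R * y - 2%:R * e = (y - 2%:R * e) * (y + e) ^+ 2.
Proof. by move=> e2; ring: e2. Qed.

(** Excludes a = 0 in characteristic 2, and with it [alpha = 0]. *)
Lemma depressed_cubic_factor2 (R : comNzRingType) (y : R) : 2%:R = 0 :> R ->
  y ^+ 3 - 3%:R * y = y * (y - 1) ^+ 2.
Proof.
move=> two0; transitivity (y * (y - 1) ^+ 2 + 2%:R * (y ^+ 2 - 2%:R * y)).
  by ring.
by rewrite two0 mul0r addr0.
Qed.

Lemma omega_cubic (R : comNzRingType) (m y a : R) :
  y ^+ 3 - 3%:R * y - a = 0 ->
  (m * y) ^+ 3 = 3%:R * m ^+ 2 * (m * y) + m ^+ 3 * a.
Proof.
move=> e; apply: (@eq_of_sub _ _ _ (m ^+ 3 * (y ^+ 3 - 3%:R * y - a)) 0).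
  by ring.
by rewrite e mulr0.
Qed.

Theorem theorem2p1 (p n : nat) (p_prime : prime p) (p_neq3 : p != 3%N)
  (F : finFieldType) (cardF : #|F| = (p ^ n)%N)
  (Omega : splittingFieldType (ratfun F)) (L : {subfield Omega})
  (sepL : separable 1 L) (dimL : \dim L = 3%N)
  (y : Omega) (genL : <<1; y>>%VS = L)
  (a : ratfun F) (y_root : y ^+ 3 - 3%:R * y - a%:A = 0)
  (alpha beta gamma beta1 beta2 : {poly F})
  (gamma_neq0 : gamma != 0)
  (aE : a = alpha%:F / (gamma ^+ 3 * beta)%:F)
  (alpha_coprime : coprimep alpha (beta * gamma))
  (beta_cubefree : power_free 3 beta)
  (betaE : beta = beta1 * beta2 ^+ 2)
  (beta1_sqfree : power_free 2 beta1) (beta2_sqfree : power_free 2 beta2)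
  (omega : Omega) (omegaE : omega = polyin Omega (gamma * beta1 * beta2) * y)
  (I S T V : {poly F})
  (V_congr : eqmodp I V (T ^+ 2 - 3%:R * (gamma * beta1 * beta2) ^+ 2))
  (T_odd : p != 2%N -> odd_case alpha beta beta1 beta2 gamma I T)
  (T_even : p = 2%N -> even_case L a alpha beta1 beta2 gamma I T) :
  integral_basis L
    [tuple 1; omega + polyin Omega S;
       (polyin Omega I)^-1 * (omega ^+ 2 + polyin Omega T * omega + polyin Omega V)].
Proof.
have three_neq0 : 3%:R != 0 :> F.
  by apply: contraNneq p_neq3 => l0; rewrite -(natr_eq0_pchar p_prime cardF _ l0).
have b10 := power_free_neq0 beta1_sqfree; have b20 := power_free_neq0 beta2_sqfree.
pose m := gamma * beta1 * beta2.
have m0 : m != 0 by rewrite !mulf_neq0.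
have me0 : polyin Omega m != 0 by rewrite polyin_eq0.
have y1 : y \notin 1%VS.
  apply/negP => /Fadjoin_idP y1; have := dimL; rewrite -genL y1 dimv1.
  by [].
have genO : <<1; omega>>%VS = L.
  have alg_in (K : {subfield Omega}) (x : ratfun F) : x%:A \in K.
    by rewrite memvZ // mem1v.
  apply/eqP; rewrite -genL eqEsubv !sub_adjoin1v omegaE; apply/andP; split.
    by rewrite memvM ?memv_adjoin // alg_in.
  rewrite -{1}(mulKf me0 y); apply: memvM; last exact: memv_adjoin.
  by rewrite /polyin -algV alg_in.
pose H := alpha * beta1 ^+ 2 * beta2.
have omega3 : omega ^+ 3 = 3%:R * polyin Omega (m ^+ 2) * omega + polyin Omega H.
  have maE : polyin Omega m ^+ 3 * a%:A = polyin Omega H.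
    rewrite -rmorphXn -algM; congr (_%:A); rewrite aE mulrA -tofracM.
    have -> : m ^+ 3 * alpha = H * (gamma ^+ 3 * beta) by rewrite /m /H betaE; ring.
    rewrite tofracM mulfK // tofrac_eq0 mulf_neq0 ?expf_neq0 //.
    exact: power_free_neq0 beta_cubefree.
  by rewrite omegaE (omega_cubic _ y_root) maE rmorphXn.
(* Both characteristics have I = beta1 J, with [J] equal to [eta2] or [alphaI]; the primes dividing
   beta1 beta2 are settled here once. *)
have basis J : I = beta1 * J -> J != 0 -> coprimep J (beta * gamma) -> beta1 %| T ->
    J %| T ^+ 2 - m ^+ 2 -> J ^+ 2 %| T ^+ 3 - 3%:R * m ^+ 2 * T - H ->
    (forall P, finite_place P -> ~~ (P %| beta1) -> ~~ (P %| beta2) ->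
       maximal_at (m ^+ 2) H (beta1 * J) T P) ->
    integral_basis L [tuple 1; omega + polyin Omega S;
       (polyin Omega I)^-1 * (omega ^+ 2 + polyin Omega T * omega + polyin Omega V)].
  move=> IE J0 copJ T1 JA JB maxP; have [IA IB] := modulus_dvd betaE copJ T1 JA JB.
  apply (integral_basis_cubic S three_neq0 dimL genO omega3); rewrite ?IE //.
  - by rewrite mulf_neq0.
  - by move: V_congr; rewrite /eqmodp IE.
  - move=> P fpP; have [Pb|] := boolP ((P %| beta1) || (P %| beta2)).
      exact: maximal_at_beta fpP.2 copJ T1 Pb.
    by rewrite negb_or => /andP[]; apply: maxP.
have y_not_alg (x : ratfun F) : y != x%:A.
  by apply: contraNneq y1 => ->; rewrite memvZ // mem1v.
have no_pm2 (e : ratfun F) : e ^+ 2 = 1 -> a != 2%:R * e.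
  move=> e2; apply/eqP => a2; have eA2 : (e%:A : Omega) ^+ 2 = 1.
    by rewrite -algX e2 scale1r.
  have := depressed_cubic_factor y eA2.
  have <- : a%:A = 2%:R * e%:A :> Omega by rewrite a2 algM alg_nat.
  rewrite y_root => /esym/eqP.
  rewrite mulf_eq0 sqrf_eq0 subr_eq0 (negPf (y_not_alg _)) /= addr_eq0 -algN.
  by rewrite (negPf (y_not_alg _)).
have X0 : gamma ^+ 3 * beta != 0.
  by rewrite mulf_neq0 ?expf_neq0 // (power_free_neq0 beta_cubefree).
have a_of_alpha (f : {poly F}) : alpha = f * (gamma ^+ 3 * beta) -> a = f%:F.
  by move=> alphaE; rewrite aE alphaE tofracM mulfK // tofrac_eq0.
have [p2|p2] := eqVneq p 2%N; last first.
  have two_neq0 : 2%:R != 0 :> F.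
    by apply: contraNneq p2 => l0; rewrite -(natr_eq0_pchar p_prime cardF _ l0).
  have [eta1 [eta2 [etaE eta1_sqfree IE Teta T1]]] := T_odd p2.
  (* If [eta2] vanished, alpha^2 would equal 4 gamma^6 beta^2, that is, a = 2 or a = -2. *)
  have eta20 : eta2 != 0.
    apply/negP => /eqP eta20.
    have pm2 : (alpha - 2%:R * 1 * (gamma ^+ 3 * beta))
        * (alpha - 2%:R * (- 1) * (gamma ^+ 3 * beta)) = 0.
      apply: (@eq_of_sub _ _ _ 0 (4%:R * gamma ^+ 6 * beta ^+ 2 - alpha ^+ 2)).
        by ring.
      by rewrite etaE eta20 expr0n mulr0.
    move/eqP: pm2; rewrite mulf_eq0 !subr_eq0 => /orP[]/eqP/a_of_alpha a2.
      have /eqP[] := no_pm2 1 (expr1n _ _).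
      by rewrite a2 tofracM tofrac1 -(rmorph_nat (@FracField.tofrac _)).
    have /eqP[] := no_pm2 (- 1) (etrans (sqrrN 1) (expr1n _ 2)).
    by rewrite a2 tofracM tofracN tofrac1 -(rmorph_nat (@FracField.tofrac _)).
  apply: (basis eta2) => //.
  - exact (odd_coprime alpha_coprime etaE).
  - by move: T1; rewrite /eqmodp subr0; apply: dvdp_trans; rewrite expr2 dvdp_mulIl.
  - have JA := odd_dvd_quadratic alpha_coprime betaE two_neq0 etaE Teta gamma_neq0 b20.
    by apply: dvdp_trans JA; rewrite expr2 dvdp_mulIl.
  - exact (odd_dvd_cubic alpha_coprime betaE two_neq0 etaE Teta gamma_neq0 b20).
  - move=> P fpP nP1 nP2.
    exact (odd_maximal_at betaE T etaE eta1_sqfree eta20 b10 fpP.2 nP1 nP2).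
have two_eq0 : 2%:R = 0 :> F.
  by apply: pcharf0; rewrite -p2; apply: card_finPcharP cardF p_prime.
have alpha0 : alpha != 0.
  apply/negP => /eqP alpha0; have a0 : a = 0 by rewrite aE alpha0 tofrac0 mul0r.
  have two0 : 2%:R = 0 :> Omega.
    by rewrite -(rmorph_nat (@polyin F Omega)) -polyC_natr two_eq0 rmorph0.
  have := depressed_cubic_factor2 y two0; move: y_root; rewrite a0 scale0r subr0 => ->.
  have y_neq0 : y != 0 by rewrite -(scale0r (1 : Omega)) y_not_alg.
  have y_neq1 : y != 1 by rewrite -(scale1r (1 : Omega)) y_not_alg.
  by move/esym/eqP; rewrite mulf_eq0 sqrf_eq0 subr_eq0 (negPf y_neq0) (negPf y_neq1).
have [r rr [gal nongal]] := T_even p2.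
have [alphaI [J [k [d [w [[IE T1 alphaE cop_kd cop_d] [Tk wE simple]]]]]]] :
  exists alphaI J k d w : {poly F},
    [/\ I = beta1 * alphaI, beta1 %| T, alpha = alphaI * J, coprimep k d
      & coprimep alphaI d] /\
    [/\ alphaI %| k - T * d, hess (m ^+ 2) H k d = alphaI ^+ 2 * w
      & forall P, finite_place P -> ~~ (P %| beta1) -> P %| J ->
          P %| w /\ ~~ (P ^+ 2 %| w)].
  have [galL|ngalL] := boolP (galois 1 L); last first.
    exact (nongalois_data alpha_coprime betaE alpha0 gamma_neq0 b20 (nongal ngalL)).
  have [r0 rE [IE T1 TaI]] := gal galL.
  have [k [d [d0 cop_kd kE cop_d Tk]]] := eqmodf_coprime TaI.
  rewrite rE in rr.
  have /dvdpP[w wE] : alpha ^+ 2 %| hess (m ^+ 2) H k d.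
    apply: (resolvent_hess _ _ d0 rr kE); last by rewrite expf_neq0.
    exact: (coprime_M alpha_coprime betaE).
  (* In the Galois case [alphaI] is [alpha], so the cofactor is 1 and the condition at its prime
     divisors is vacuous. *)
  rewrite [w * _]mulrC in wE; exists alpha, 1, k, d, w; split; split=> //.
  - by move: T1; rewrite /eqmodp subr0.
  - by rewrite mulr1.
  by move=> P fpP _ P1; have /negP[] := irredp_not_dvd1 fpP.2 (size_poly1 F).
apply: (basis alphaI) => //.
- by apply: contraNneq alpha0 => e; rewrite alphaE e mul0r.
- exact (even_coprime alpha_coprime alphaE).
- exact (even_dvd_quadratic alpha_coprime betaE two_eq0 alphaE cop_d Tk wE).
- exact (even_dvd_cubic alpha_coprime betaE two_eq0 alpha0 alphaE cop_d Tk wE).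
- move=> P fpP nP1 nP2; apply (even_maximal_at alpha_coprime betaE two_eq0 alpha0 b10
    alphaE cop_kd Tk wE fpP.2 nP1 nP2).
  exact: simple.
Qed.
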